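(* Let $\varphi\colon M^{m}\to \mathbb{S}^{n-\ell}\times \mathbb{R}^{\ell}$ be an isometric immersion of a compact Riemannian $m$-manifold $M^{m}$ into the Riemannian product $\mathbb{S}^{n-\ell}\times\mathbb{R}^\ell$, with $n+\ell\leq 2m-1$. If $\sup K_{M}\leq 1$, then the extrinsic radius $R_M$ of the immersion satisfies $$R_{M}\geq \frac{\pi}{2}.$$
   Context: $\mathbb{S}^{n-\ell}$ is the round unit sphere (constant sectional curvature $1$) of dimension $n-\ell$. Manifolds are connected. $\sup K_M$ is the supremum of the sectional curvatures of $M$ over all points and all tangent $2$-planes. The extrinsic radius $R_M$ of the immersion is the radius of the smallest geodesic ball of $\mathbb{S}^{n-\ell}$ containing $\pi(\varphi(M))$, where $\pi\colon \mathbb{S}^{n-\ell}\times\mathbb{R}^\ell\to \mathbb{S}^{n-\ell}$ is the projection onto the first factor. *)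

(* Defs.v *)
From HB Require Import structures.
From mathcomp Require Import all_boot all_order all_algebra.
From mathcomp Require Import all_classical all_reals all_analysis.

Set Implicit Arguments.
Unset Strict Implicit.
Unset Printing Implicit Defensive.
Import Order.TTheory GRing.Theory Num.Theory.
Import numFieldNormedType.Exports.
Local Open Scope classical_set_scope.
Local Open Scope ring_scope.

(* The library norm on 'rV[R]_k is the sup norm; it is used here only for its
   topology.  All metric notions go through dotp and enorm. *)
Definition dotp (R : realType) (k : nat) (u v : 'rV[R]_k) : R :=
  \sum_(i < k) u 0 i * v 0 i.

Definition enorm (R : realType) (k : nat) (u : 'rV[R]_k) : R :=
  Num.sqrt (dotp u u).

Definition partial (R : realType) (m : nat) (i : 'I_m) (f : 'rV[R]_m -> R) :
  'rV[R]_m -> R := fun x => 'D_(delta_mx 0 i) f x.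

Definition iter_partial (R : realType) (m : nat) (s : seq 'I_m)
  (f : 'rV[R]_m -> R) : 'rV[R]_m -> R := foldr (@partial R m) f s.

(* C^oo on U, for U open: partial derivatives of all orders exist and are
   continuous at each point of U. *)
Definition smooth_on (R : realType) (m : nat) (U : set 'rV[R]_m)
  (f : 'rV[R]_m -> R) : Prop :=
  forall (s : seq 'I_m) (x : 'rV[R]_m), U x ->
    {for x, continuous (iter_partial s f)} /\
    forall i : 'I_m, derivable (iter_partial s f) x (delta_mx 0 i).

Definition smooth_map_on (R : realType) (m k : nat) (U : set 'rV[R]_m)
  (f : 'rV[R]_m -> 'rV[R]_k) : Prop :=
  forall j : 'I_k, smooth_on U (fun x => f x 0 j).

(* Row-vector convention: row i is the i-th partial derivative of f, so the
   differential of f at x sends u to u *m jac f x. *)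
Definition jac (R : realType) (m k : nat) (f : 'rV[R]_m -> 'rV[R]_k)
  (x : 'rV[R]_m) : 'M[R]_(m, k) :=
  \matrix_(i < m, j < k) partial i (fun y => f y 0 j) x.

(* cinv is a total function, meaningful only on the open set cmap @` cdom. *)
Record chart (R : realType) (m : nat) (M : topologicalType) := Chart {
  cdom : set M ;
  cmap : M -> 'rV[R]_m ;
  cinv : 'rV[R]_m -> M ;
  cdom_open : open cdom ;
  cimg_open : open (cmap @` cdom) ;
  cmapK : {in cdom, cancel cmap cinv} ;
  cmap_cont : {within cdom, continuous cmap} ;
  cinv_cont : {within cmap @` cdom, continuous cinv} }.

Definition cimg (R : realType) (m : nat) (M : topologicalType)
  (c : chart R m M) : set 'rV[R]_m := cmap c @` cdom c.

Definition transition (R : realType) (m : nat) (M : topologicalType)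
  (c d : chart R m M) : 'rV[R]_m -> 'rV[R]_m := cmap d \o cinv c.

Record smoothManifold (R : realType) (m : nat) := SmoothManifold {
  points :> topologicalType ;
  atlas : set (chart R m points) ;
  manifold_hausdorff : hausdorff_space points ;
  manifold_second_countable : @second_countable points ;
  manifold_nonempty : [set: points] !=set0 ;
  manifold_connected : connected [set: points] ;
  atlas_cover : forall p : points, exists2 c, atlas c & cdom c p ;
  atlas_compat : forall c d, atlas c -> atlas d ->
    smooth_map_on (cmap c @` (cdom c `&` cdom d)) (transition c d) }.

(* metric c x is the Gram matrix (g_ij(x)) of the metric in the coordinates of
   the chart c, at the point with coordinates x; metric_change is the
   transformation law of a covariant 2-tensor. *)
Record riemannianManifold (R : realType) (m : nat) := RiemannianManifold {
  manifold :> smoothManifold R m ;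
  metric : chart R m manifold -> 'rV[R]_m -> 'M[R]_m ;
  metric_smooth : forall c, atlas c ->
    forall i j : 'I_m, smooth_on (cimg c) (fun x => metric c x i j) ;
  metric_sym : forall c x, atlas c -> cimg c x ->
    (metric c x)^T = metric c x ;
  metric_pos : forall c x, atlas c -> cimg c x ->
    forall u : 'rV[R]_m, u != 0 -> 0 < (u *m metric c x *m u^T) 0 0 ;
  metric_change : forall c d p, atlas c -> atlas d -> cdom c p -> cdom d p ->
    metric c (cmap c p) =
      jac (transition c d) (cmap c p) *m metric d (cmap d p)
        *m (jac (transition c d) (cmap c p))^T }.

Section Curvature.
Variables (R : realType) (m : nat) (g : 'rV[R]_m -> 'M[R]_m).

(* Gamma^k_ij = 1/2 g^kl (d_i g_jl + d_j g_il - d_l g_ij) *)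
Definition christoffel (k i j : 'I_m) (x : 'rV[R]_m) : R :=
  2^-1 * \sum_(l < m) invmx (g x) k l *
    (partial i (fun y => g y j l) x + partial j (fun y => g y i l) x
     - partial l (fun y => g y i j) x).

(* R(d_i, d_j) d_k = sum_l (riemann l k i j) d_l, where
   R(X, Y) Z = D_X D_Y Z - D_Y D_X Z - D_[X, Y] Z *)
Definition riemann (l k i j : 'I_m) (x : 'rV[R]_m) : R :=
  partial i (christoffel l j k) x - partial j (christoffel l i k) x
  + \sum_(p < m) (christoffel l i p x * christoffel p j k x
                  - christoffel l j p x * christoffel p i k x).

Definition inner (x u v : 'rV[R]_m) : R := (u *m g x *m v^T) 0 0.

(* R(u, v) w *)
Definition curv_op (x u v w : 'rV[R]_m) : 'rV[R]_m :=
  \row_(l < m) \sum_(i < m) \sum_(j < m) \sum_(k < m)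
    riemann l k i j x * u 0 i * v 0 j * w 0 k.

Definition sectional (x u v : 'rV[R]_m) : R :=
  inner x (curv_op x u v v) u /
    (inner x u u * inner x v v - inner x u v ^+ 2).

End Curvature.

(* A tangent 2-plane at a point is given by a basis (u, v), in the coordinates
   of some chart of the atlas.  The supremum is -oo if m < 2. *)
Definition sup_sectional (R : realType) (m : nat) (M : riemannianManifold R m) :
  \bar R :=
  ereal_sup [set a : \bar R | exists (c : chart R m M) (p : M) (u v : 'rV[R]_m),
    [/\ atlas c, cdom c p, row_free (col_mx u v) &
        a = (sectional (metric c) (cmap c p) u v)%:E]].

(* The unit sphere of dimension k, in R^(k+1). *)
Definition sphere (R : realType) (k : nat) : set 'rV[R]_k.+1 :=
  [set x | dotp x x = 1].

(* The speed is allowed to vanish, so that piecewise C^1 curves are covered up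
   to reparametrization. *)
Definition sphere_curve (R : realType) (k : nat) (x y : 'rV[R]_k.+1)
  (gam : R -> 'rV[R]_k.+1) : Prop :=
  [/\ forall t : R, derivable gam t 1,
      continuous (derive1 gam),
      forall t : R, 0 <= t <= 1 -> sphere (gam t),
      gam 0 = x & gam 1 = y].

Definition curve_length (R : realType) (k : nat) (gam : R -> 'rV[R]_k) :
  \bar R :=
  (\int[@lebesgue_measure R]_(t in `[0%R, 1%R]) (enorm (derive1 gam t))%:E)%E.

(* Riemannian distance of the round sphere; +oo between the two points of the
   0-sphere. *)
Definition sphere_dist (R : realType) (k : nat) (x y : 'rV[R]_k.+1) : \bar R :=
  ereal_inf [set curve_length gam | gam in sphere_curve x y].

Definition geodesic_ball (R : realType) (k : nat) (x : 'rV[R]_k.+1) (r : R) :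
  set 'rV[R]_k.+1 :=
  [set y | sphere y /\ (sphere_dist x y <= r%:E)%E].

(* The Riemannian product of the k-sphere and R^l is the subset
   {z | sphere z.1} of R^(k+1) x R^l, with the induced metric; a map into it
   is smooth iff it is smooth as a map into R^(k+1) x R^l. *)
Record isometric_immersion (R : realType) (m k l : nat)
    (M : riemannianManifold R m) (phi : M -> 'rV[R]_k.+1 * 'rV[R]_l) : Prop := {
  imm_target : forall p : M, sphere (phi p).1 ;
  imm_smooth1 : forall c : chart R m M, atlas c ->
    smooth_map_on (cimg c) (fun x => (phi (cinv c x)).1) ;
  imm_smooth2 : forall c : chart R m M, atlas c ->
    smooth_map_on (cimg c) (fun x => (phi (cinv c x)).2) ;
  imm_inj : forall (c : chart R m M) x, atlas c -> cimg c x ->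
    row_free (row_mx (jac (fun y => (phi (cinv c y)).1) x)
                     (jac (fun y => (phi (cinv c y)).2) x)) ;
  imm_isometric : forall (c : chart R m M) x, atlas c -> cimg c x ->
    forall u v : 'rV[R]_m,
      inner (metric c) x u v =
        dotp (u *m jac (fun y => (phi (cinv c y)).1) x)
             (v *m jac (fun y => (phi (cinv c y)).1) x)
        + dotp (u *m jac (fun y => (phi (cinv c y)).2) x)
               (v *m jac (fun y => (phi (cinv c y)).2) x) }.

(* Infimum of the radii of the geodesic balls of the k-sphere containing the
   projection of the image of phi. *)
Definition extrinsic_radius (R : realType) (k l : nat) (M : Type)
  (phi : M -> 'rV[R]_k.+1 * 'rV[R]_l) : \bar R :=
  ereal_inf [set a : \bar R | exists (x : 'rV[R]_k.+1) (r : R),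
    [/\ sphere x, 0 <= r, range (fst \o phi) `<=` geodesic_ball x r &
        a = r%:E]].

(* Main.v *)
Require Import Defs.
From HB Require Import structures.
From mathcomp Require Import all_boot all_order all_algebra.
From mathcomp Require Import all_classical all_reals all_analysis.
From mathcomp Require Import ring lra zify.
Import Order.TTheory GRing.Theory Num.Theory.
Import numFieldNormedType.Exports.
Local Open Scope classical_set_scope.
Local Open Scope ring_scope.
Set Implicit Arguments.
Unset Strict Implicit.

(** Why the theorem holds.  If the extrinsic radius were less than [pi / 2], the
    projection of [M] would lie in a closed geodesic ball of radius
    [r < pi / 2] about some point [e] of the sphere.  A curve of the sphere
    that leaves [e] and reaches the hemisphere [dotp e y <= 0] has length at
    least [pi / 2], so the height [h p = dotp e (phi p).1] is positive on [M]
    ([geodesic_ball_dotp_gt0]).  By compactness [h] attains its minimum at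
    some point [p].  The contradiction is a tangent plane at [p] with
    sectional curvature greater than 1 ([exists_sectional_gt1]); it is found
    in the coordinates of one chart.

    View [M] as immersed in the Euclidean space that contains the product of
    the sphere and [R^l].  Let [B] be its second fundamental form at [p], let
    [nu] be the outer unit normal of the cylinder over the sphere, and let [K]
    be the space of tangent vectors with vanishing [R^l] component.  On [K]
    the [nu] component of [B (u, v)] is minus the inner product of [u] and
    [v], so [alpha (u, v) = B (u, v) + <u, v> nu] is orthogonal to [M] and to
    [nu]: it is the second fundamental form of [M] in the product.  At the
    minimum of [h] the Hessian of [h] is nonnegative, and it equals
    [<e, B (u, u)>]; hence [<e, alpha (u, u)>] is at least [h p] times the
    squared length of [u], and [alpha (u, u)] is nonzero for nonzero [u] in
    [K].

    Now [K] has dimension at least [m - l], while [alpha] takes values in a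
    space of dimension [n - m], which is smaller.  Otsuki's argument ([otsuki])
    applies: take [u] minimising the norm of [alpha (u, u)] over the unit
    vectors of [K].  The first order condition confines [alpha (u, v)], for [v]
    orthogonal to [u], to the orthogonal complement of [alpha (u, u)], so by a
    dimension count some such nonzero [v] has [alpha (u, v) = 0]; the second
    order condition then forces [<alpha (u, u), alpha (v, v)> > 0].  By the
    Gauss equation ([gauss_curvature_term]) the plane spanned by [u] and [v]
    has sectional curvature
    [1 + <alpha (u, u), alpha (v, v)> / (|u|^2 |v|^2)], which exceeds 1. *)

(** * Directional derivatives *)

Lemma is_derive_line (R : realType) (V : normedModType R) (f : V -> R)
    (x v : V) (t : R) (d : R) :
  is_derive (t *: v + x) v f d -> is_derive t 1 (fun s => f (s *: v + x)) d.
Proof.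
have E : (fun h : R => h^-1 *: (((fun s => f (s *: v + x)) \o shift t) (h *: 1)
            - f (t *: v + x)))
       = (fun h : R => h^-1 *: ((f \o shift (t *: v + x)) (h *: v) - f (t *: v + x))).
  by apply/funext => h /=; rewrite [h *: 1]mulr1 scalerDl addrA.
by case=> df <-; split; rewrite /derivable /derive E.
Qed.

(** The mean value theorem along a line through [x], with an increment [a] of
    either sign. *)
Lemma MVT_dir (R : realType) (V : normedModType R) (f : V -> R)
    (x v : V) (a : R) :
  (forall s : R, `|s| <= `|a| -> derivable f (s *: v + x) v) ->
  exists2 s : R, `|s| <= `|a| & f (a *: v + x) - f x = a * 'D_v f (s *: v + x).
Proof.
move=> df; pose g (s : R) : R := f (s *: v + x).
have dg (s : R) : `|s| <= `|a| -> is_derive s 1 g ('D_v f (s *: v + x)).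
  by move=> sa; apply/is_derive_line/derivableP/df.
have cg (b c : R) : (forall s, b <= s <= c -> `|s| <= `|a|) ->
    {within `[b, c], continuous g}.
  move=> H; apply: derivable_within_continuous => s; rewrite in_itv/= => /H sa.
  by have [] := dg _ sa.
have g0 : g 0 = f x by rewrite /g scale0r add0r.
rewrite -g0 -/(g a); have [a0|a0] := leP 0 a.
- have H s : 0 <= s <= a -> `|s| <= `|a|.
    by move=> /andP[s0 sa]; rewrite !ger0_norm.
  have [|s] := @MVT_segment R g (fun s => 'D_v f (s *: v + x)) _ _ a0 _ (cg _ _ H).
    by move=> s; rewrite in_itv/= => /andP[? ?]; apply/dg/H; rewrite !ltW.
  rewrite in_itv/= => /H sa ->; exists s => //.
  by rewrite subr0 mulrC.
- have H s : a <= s <= 0 -> `|s| <= `|a|.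
    by move=> /andP[s0 sa]; rewrite !ler0_norm ?lerN2// ltW.
  have [|s] := @MVT_segment R g (fun s => 'D_v f (s *: v + x)) _ _ (ltW a0) _ (cg _ _ H).
    by move=> s; rewrite in_itv/= => /andP[? ?]; apply/dg/H; rewrite !ltW.
  rewrite in_itv/= => /H sa E; exists s => //.
  by rewrite -opprB E sub0r mulrN opprK mulrC.
Qed.

(** The induction step from partial to directional derivatives.  By the mean
    value theorem the increment of [f] in the direction [c *: e], taken at
    the moving base point [h *: w + x], is [h * c] times a value of ['D_e f]
    at a point near [x]; continuity of ['D_e f] at [x] replaces that value by
    ['D_e f x]. *)
Lemma is_derive_add_dir (R : realType) (V : normedModType R) (f : V -> R)
    (x w e : V) (c d : R) :
  (\forall y \near x, derivable f y e) -> {for x, continuous ('D_e f)} ->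
  is_derive x w f d -> is_derive x (w + c *: e) f (d + c * 'D_e f x).
Proof.
move=> ndf cdf [dw <-].
suff cv : (fun h : R => h^-1 *: (f (h *: (w + c *: e) + x) - f (h *: w + x)))
    @ 0^' --> (c * 'D_e f x : R^o).
  have E : (fun h : R => h^-1 *: ((f \o shift x) (h *: (w + c *: e)) - f x)) =
     (fun h : R => h^-1 *: ((f \o shift x) (h *: w) - f x) +
                   h^-1 *: (f (h *: (w + c *: e) + x) - f (h *: w + x))).
    by apply/funext => h /=; rewrite -scalerDr; congr (_ *: _); ring.
  have L : (fun h : R => h^-1 *: ((f \o shift x) (h *: (w + c *: e)) - f x))
      @ 0^' --> ('D_w f x + c * 'D_e f x : R^o).
    by rewrite E; apply: cvgD.
  by split; [apply/cvg_ex; eexists; exact: L | exact/cvg_lim].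
apply/cvgrPdist_le => /= eps eps0.
have k0 : 0 < eps / (`|c| + 1) by rewrite divr_gt0// ltr_wpDl.
have [r /= r0 rP] : exists2 r : R, 0 < r & forall y, `|x - y| < r ->
    derivable f y e /\ `|'D_e f x - 'D_e f y| <= eps / (`|c| + 1).
  have /cvgrPdist_le/(_ _ k0) Hc := cdf.
  have /nbhs_normP[r r0 H] : nbhs x (fun y => derivable f y e /\
      `|'D_e f x - 'D_e f y| <= eps / (`|c| + 1)).
    by near=> y; split; near: y.
  by exists r => // y yr; apply: H.
(* for [`|h| < r / B] every point met below is within [r] of [x] *)
pose B := `|w| + `|c| * `|e| + 1.
have B0 : 0 < B by rewrite /B ltr_wpDl// addr_ge0// mulr_ge0.
near=> h.
have hn0 : h != 0 by near: h; exact: nbhs_dnbhs_neq.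
have hr : `|h| < r / B by near: h; apply: dnbhs0_lt; rewrite divr_gt0.
have near_x s : `|s| <= `|h * c| -> `|x - (s *: e + (h *: w + x))| < r.
  move=> sc; rewrite -normrN opprB addrA addrK.
  rewrite (le_lt_trans (ler_normD _ _))// !normrZ.
  rewrite (@le_lt_trans _ _ (`|h| * B))//; last by rewrite -ltr_pdivlMr.
  rewrite /B !mulrDr mulr1 addrC -addrA lerD// mulrA.
  by rewrite -[leLHS]addr0 lerD// ler_wpM2r// (le_trans sc)// normrM.
have [s sc E] := @MVT_dir R V f (h *: w + x) e (h * c)
  (fun s sc => (rP _ (near_x s sc)).1).
have -> : h *: (w + c *: e) + x = (h * c) *: e + (h *: w + x).
  by rewrite scalerDr scalerA addrAC addrC.
rewrite E [h^-1 *: _]mulrA mulrA mulVf// mul1r -mulrBr normrM.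
have [_ le] := rP _ (near_x s sc).
rewrite (le_trans (ler_wpM2l _ le))// mulrCA ger_pMr//.
by rewrite ler_pdivrMr ?mul1r ?ltr_wpDl// lerDl.
Unshelve. all: by end_near. Qed.

(** A function with continuous partial derivatives has directional derivatives
    that are linear in the direction: the coordinate directions are added one
    at a time. *)
Lemma is_derive_partials (R : realType) (m : nat) (f : 'rV[R]_m -> R)
    (x : 'rV[R]_m) :
  (forall i : 'I_m, \forall y \near x, derivable f y (delta_mx 0 i)) ->
  (forall i : 'I_m, {for x, continuous (partial i f)}) ->
  forall u : 'rV[R]_m, is_derive x u f (\sum_i u 0 i * partial i f x).
Proof.
move=> df cf u; rewrite {1}(row_sum_delta u).
elim/big_rec2: _ => [|i d w _ IH]; first exact: is_derive0.
by rewrite (addrC _ w) (addrC _ d); apply: is_derive_add_dir (df i) (cf i) IH.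
Qed.

Lemma is_derive_translate (R : realType) (V : normedModType R) (f : V -> R)
    (v y a : V) (d : R) :
  is_derive (v + y) a f d -> is_derive y a (fun z => f (v + z)) d.
Proof.
have E : (fun h : R => h^-1 *: (((fun z => f (v + z)) \o shift y) (h *: a)
            - f (v + y)))
       = (fun h : R => h^-1 *: ((f \o shift (v + y)) (h *: a) - f (v + y))).
  by apply/funext => h /=; rewrite addrCA.
by case=> df <-; split; rewrite /derivable /derive E.
Qed.

(** The increment along [t *: b] of the increment along [t *: a] does not
    depend on the order of the two increments, whereas the two applications of
    the mean value theorem produce ['D_b ('D_a f)] in one order and
    ['D_a ('D_b f)] in the other. *)
Lemma second_difference (R : realType) (V : normedModType R) (f : V -> R)
    (x a b : V) (t : R) :
  (forall y, `|x - y| <= `|t| * (`|a| + `|b|) ->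
     derivable f y a /\ derivable ('D_a f) y b) ->
  exists2 y, `|x - y| <= `|t| * (`|a| + `|b|) &
    f (t *: b + (t *: a + x)) - f (t *: a + x) - (f (t *: b + x) - f x) =
    t * (t * 'D_b ('D_a f) y).
Proof.
move=> H; pose F z := f (t *: b + z) - f z.
have nb (s s' : R) : `|s| <= `|t| -> `|s'| <= `|t| ->
    `|x - (s' *: b + (s *: a + x))| <= `|t| * (`|a| + `|b|).
  move=> st s't; rewrite -normrN opprB addrA addrK addrC mulrDr.
  rewrite (le_trans (ler_normD _ _))// !normrZ lerD// ler_wpM2r//.
have nb0 (s : R) : `|s| <= `|t| ->
    `|x - (s *: a + x)| <= `|t| * (`|a| + `|b|).
  by move=> st; have := nb s 0 st; rewrite normr0 scale0r add0r; apply.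
have dF (s : R) : `|s| <= `|t| -> is_derive (s *: a + x) a F
    ('D_a f (t *: b + (s *: a + x)) - 'D_a f (s *: a + x)).
  move=> st; apply: is_deriveB.
    by apply/is_derive_translate/derivableP; apply: (H _ (nb _ _ st (lexx _))).1.
  exact/derivableP/((H _ (nb0 _ st)).1).
have [|s st E] := @MVT_dir R V F x a t.
  by move=> s /dF[].
have [s' s't E'] := @MVT_dir R V ('D_a f) (s *: a + x) b t
   (fun s' s't => (H _ (nb _ _ st s't)).2).
exists (s' *: b + (s *: a + x)); first exact: nb.
by rewrite -E' -(@derive_val _ _ _ _ _ _ _ (dF _ st)) -E.
Qed.

(** Schwarz's theorem: both iterated derivatives are limits of the same second
    difference divided by [t ^+ 2]. *)
Lemma derive_sym (R : realType) (V : normedModType R) (f : V -> R)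
    (x a b : V) :
  (\forall y \near x, [/\ derivable f y a, derivable ('D_a f) y b,
      derivable f y b & derivable ('D_b f) y a]) ->
  {for x, continuous ('D_b ('D_a f))} -> {for x, continuous ('D_a ('D_b f))} ->
  'D_b ('D_a f) x = 'D_a ('D_b f) x.
Proof.
move=> ndf c1 c2; apply/eqP; rewrite -subr_eq0 -normr_le0.
apply/ler_addgt0Pl => e e0; rewrite addr0.
have e2 : 0 < e / 2 by rewrite divr_gt0.
have [r /= r0 rP] : exists2 r : R, 0 < r & forall y, `|x - y| < r ->
    [/\ derivable f y a, derivable ('D_a f) y b,
      derivable f y b & derivable ('D_b f) y a] /\
    (`|'D_b ('D_a f) x - 'D_b ('D_a f) y| <= e / 2 /\
     `|'D_a ('D_b f) x - 'D_a ('D_b f) y| <= e / 2).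
  have /cvgrPdist_le/(_ _ e2) H1 := c1.
  have /cvgrPdist_le/(_ _ e2) H2 := c2.
  have /nbhs_normP[r r0 H] : nbhs x (fun y => [/\ derivable f y a,
      derivable ('D_a f) y b, derivable f y b & derivable ('D_b f) y a] /\
    (`|'D_b ('D_a f) x - 'D_b ('D_a f) y| <= e / 2 /\
     `|'D_a ('D_b f) x - 'D_a ('D_b f) y| <= e / 2)).
    exact: (filterI ndf (filterI H1 H2)).
  by exists r => // y yr; apply: H.
pose B := `|a| + `|b| + 1.
have B0 : 0 < B by rewrite /B ltr_wpDl// addr_ge0.
pose t := r / 2 / B.
have t0 : 0 < t by rewrite /t !divr_gt0.
have tr : `|t| * (`|a| + `|b|) < r.
  rewrite ger0_norm ?ltW// (@le_lt_trans _ _ (t * B))//.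
    by rewrite ler_wpM2l ?(ltW t0)// /B lerDl.
  by rewrite /t divfK ?gt_eqF// ltr_pdivrMr// ltr_pMr// ltr1n.
have [|y1 y1P E1] := @second_difference R V f x a b t.
  by move=> y yt; have [[]] := rP _ (le_lt_trans yt tr).
have [|y2 y2P E2] := @second_difference R V f x b a t.
  move=> y; rewrite [`|b| + _]addrC => yt; have [[]] := rP _ (le_lt_trans yt tr).
  by [].
have E : 'D_b ('D_a f) y1 = 'D_a ('D_b f) y2.
  apply: (@mulfI _ t); first by rewrite gt_eqF.
  apply: (@mulfI _ t); first by rewrite gt_eqF.
  have sub4 (p q r' s : R) : p - q - (r' - s) = p - r' - (q - s) by ring.
  by rewrite -E1 -E2 (addrCA (t *: b)) sub4.
have [_ [h1 _]] := rP _ (le_lt_trans y1P tr).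
rewrite [`|b| + _]addrC in y2P.
have [_ [_ h2]] := rP _ (le_lt_trans y2P tr).
apply: le_trans (ler_distD ('D_b ('D_a f) y1) _ _) _.
by rewrite [e]splitr; apply: (lerD h1); rewrite E distrC.
Unshelve. all: by end_near. Qed.

(** Were [H] negative, [psi] would be negative at the points that follow [x] on
    the ray of direction [u], and [f] would decrease there. *)
Lemma second_derivative_test (R : realType) (V : normedModType R)
    (f psi : V -> R) (x u : V) (H : R) :
  (\forall y \near x, is_derive y u f (psi y)) -> is_derive x u psi H ->
  (forall y, f x <= f y) -> psi x = 0 /\ 0 <= H.
Proof.
move=> ndf dpsi fmin; pose phi (s : R) : R := f (s *: u + x).
have [r /= r0 rP] : exists2 r : R, 0 < r &
    forall s : R, `|s| < r -> is_derive s 1 phi (psi (s *: u + x)).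
  have /nbhs_normP[r r0 H'] := ndf.
  exists (r / (`|u| + 1)); first by rewrite divr_gt0// ltr_wpDl.
  move=> s sr; apply/is_derive_line/H' => /=.
  rewrite -normrN opprB addrK normrZ.
  rewrite (@le_lt_trans _ _ (`|s| * (`|u| + 1)))// ?ler_wpM2l// ?lerDl//.
  by rewrite -ltr_pdivlMr// ltr_wpDl.
have psi0 : psi x = 0.
  have I0 : 0 \in `](- r), r[%R by rewrite in_itv/= oppr_lt0 r0.
  have D0 := rP 0; rewrite normr0 scale0r add0r in D0.
  have [_ <-] := D0 r0.
  have [|||_ ->//] := @derive1_at_min R phi (- r) r 0 _ _ I0.
  - by rewrite lerNl (le_trans _ (ltW r0))// oppr_le0 ltW.
  - by move=> s; rewrite in_itv/= -ltr_norml => /rP[].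
  - by move=> s _; rewrite /phi scale0r add0r.
split => //; rewrite leNgt; apply/negP => H0.
have {}dpsi : (fun h : R => h^-1 *: ((psi \o shift x) (h *: u) - psi x)) @ 0^'
    --> (H : R^o).
  by case: dpsi => /[swap] <-.
have /nbhs_normP[r' /= r'0 r'P] :
    \forall h \near 0^', h^-1 *: ((psi \o shift x) (h *: u) - psi x) < 0.
  exact: (cvgr_lt _ dpsi).
pose a := Num.min r r' / 2.
have a0 : 0 < a by rewrite divr_gt0// lt_min r0 r'0.
have ar : a < r /\ a < r'.
  have : a < Num.min r r' by rewrite /a ltr_pdivrMr// ltr_pMr ?ltr1n// lt_min r0.
  by rewrite lt_min => /andP.
have [||c] := @MVT R phi (fun s => psi (s *: u + x)) 0 a a0.
- move=> s; rewrite in_itv/= => /andP[s0 sa]; apply: rP.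
  by rewrite gtr0_norm// (lt_trans sa)// ar.1.
- apply: derivable_within_continuous => s; rewrite in_itv/= => /andP[s0 sa].
  by case: (rP s) => //; rewrite ger0_norm// (le_lt_trans sa)// ar.1.
rewrite in_itv/= => /andP[c0 ca] E.
have : 0 <= psi (c *: u + x) * (a - 0).
  by rewrite -E subr_ge0 /phi scale0r add0r.
rewrite subr0 pmulr_lge0// leNgt => /negP; apply.
have := r'P c; rewrite /= sub0r normrN gtr0_norm// psi0 subr0.
move=> /(_ (lt_trans ca ar.2)); rewrite gt_eqF// => /(_ isT).
by rewrite pmulr_rlt0// invr_gt0.
Unshelve. all: by end_near. Qed.

(** * The Euclidean inner product *)

Section Dotp.
Variables (R : realType) (k : nat).
Implicit Types u v w : 'rV[R]_k.

Lemma dotpE u v : dotp u v = (u *m v^T) 0 0.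
Proof. by rewrite mxE; apply: eq_bigr => i _; rewrite mxE. Qed.

Lemma dotpC u v : dotp u v = dotp v u.
Proof. by apply: eq_bigr => i _; rewrite mulrC. Qed.

Lemma dotpDl u v w : dotp (u + v) w = dotp u w + dotp v w.
Proof. by rewrite !dotpE mulmxDl mxE. Qed.

Lemma dotpDr u v w : dotp u (v + w) = dotp u v + dotp u w.
Proof. by rewrite dotpC dotpDl !(dotpC u). Qed.

Lemma dotpZl a u v : dotp (a *: u) v = a * dotp u v.
Proof. by rewrite !dotpE -scalemxAl mxE. Qed.

Lemma dotpZr a u v : dotp u (a *: v) = a * dotp u v.
Proof. by rewrite dotpC dotpZl (dotpC u). Qed.

Lemma dotpNl u v : dotp (- u) v = - dotp u v.
Proof. by rewrite -scaleN1r dotpZl mulN1r. Qed.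

Lemma dotpNr u v : dotp u (- v) = - dotp u v.
Proof. by rewrite dotpC dotpNl (dotpC u). Qed.

Lemma dot0p v : dotp 0 v = 0.
Proof. by rewrite -(scale0r v) dotpZl mul0r. Qed.

Lemma dotp0 v : dotp v 0 = 0.
Proof. by rewrite dotpC dot0p. Qed.

Lemma dotp_suml (I : Type) (r : seq I) (P : pred I) (F : I -> 'rV[R]_k) v :
  dotp (\sum_(i <- r | P i) F i) v = \sum_(i <- r | P i) dotp (F i) v.
Proof.
by elim/big_rec2: _ => [|i a w _ IH]; rewrite ?dot0p// dotpDl IH.
Qed.

Lemma dotp_sumr (I : Type) (r : seq I) (P : pred I) (F : I -> 'rV[R]_k) v :
  dotp v (\sum_(i <- r | P i) F i) = \sum_(i <- r | P i) dotp v (F i).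
Proof. by rewrite dotpC dotp_suml; apply: eq_bigr => i _; rewrite dotpC. Qed.

Lemma dotp_ge0 u : 0 <= dotp u u.
Proof. by apply: sumr_ge0 => i _; rewrite -expr2 sqr_ge0. Qed.

Lemma dotp_eq0 u : (dotp u u == 0) = (u == 0).
Proof.
apply/eqP/eqP => [|->]; last exact: dot0p.
move=> /eqP; rewrite psumr_eq0 => [/allP H|i _]; last by rewrite -expr2 sqr_ge0.
apply/rowP => i; rewrite mxE; apply/eqP.
by have := H i (mem_index_enum _); rewrite mulf_eq0 orbb.
Qed.

Lemma dotp_gt0 u : (0 < dotp u u) = (u != 0).
Proof. by rewrite lt_neqAle dotp_ge0 andbT eq_sym dotp_eq0. Qed.

Lemma dotp_CauchySchwarz u v : dotp u v ^+ 2 <= dotp u u * dotp v v.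
Proof.
have [->|v0] := eqVneq v 0; first by rewrite !dotp0 mulr0 expr0n.
have vv : 0 < dotp v v by rewrite dotp_gt0.
rewrite -subr_ge0 -(pmulr_rge0 _ vv).
have := dotp_ge0 (dotp v v *: u - dotp u v *: v).
rewrite !(dotpDl, dotpDr, dotpNl, dotpNr, dotpZl, dotpZr) (dotpC v u).
by congr (_ <= _); ring.
Qed.

Lemma enorm_ge0 u : 0 <= enorm u.
Proof. exact: sqrtr_ge0. Qed.

Lemma dotp_le_enorm u v : dotp u v <= enorm u * enorm v.
Proof.
rewrite /enorm -sqrtrM ?dotp_ge0// (le_trans (ler_norm _))//.
by rewrite -sqrtr_sqr ler_sqrt ?dotp_CauchySchwarz// mulr_ge0// dotp_ge0.
Qed.

Lemma is_derive_dotp (V : normedModType R) (f g : V -> 'rV[R]_k) (x v : V)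
    (df dg : 'rV[R]_k) :
  (forall a, is_derive x v (fun y => f y 0 a) (df 0 a)) ->
  (forall a, is_derive x v (fun y => g y 0 a) (dg 0 a)) ->
  is_derive x v (fun y => dotp (f y) (g y)) (dotp df (g x) + dotp (f x) dg).
Proof.
move=> Df Dg; rewrite /dotp -big_split /=.
have -> : (fun y => \sum_(i < k) f y 0 i * g y 0 i) =
   \sum_(i < k) (fun y => f y 0 i * g y 0 i).
  by apply/funext => y; rewrite fct_sumE.
apply: is_derive_sum => i.
apply: (is_derive_eq (@is_deriveM _ _ _ _ _ _ _ _ (Df i) (Dg i))).
by rewrite addrC; congr (_ + _); rewrite /GRing.scale/= mulrC.
Qed.

Lemma continuous_dotp (T : topologicalType) (f g : T -> 'rV[R]_k) (x : T) :
  (forall a, {for x, continuous (fun y => f y 0 a)}) ->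
  (forall a, {for x, continuous (fun y => g y 0 a)}) ->
  {for x, continuous (fun y => dotp (f y) (g y))}.
Proof.
move=> cf cg; apply: cvg_big; first exact: add_continuous.
by move=> i _; apply: cvgM; [exact: cf|exact: cg].
Qed.
End Dotp.


(** * Length of curves on the sphere *)

Lemma asin_le0 (R : realType) (z : R) : -1 <= z <= 0 -> asin z <= 0.
Proof.
move=> /andP[z1 z0]; have zz : -1 <= z <= 1 by rewrite z1 (le_trans z0).
rewrite leNgt; apply/negP => a0.
have : 0 < sin (asin z).
  by rewrite sin_gt0_pi// a0/= (le_lt_trans (asin_lepi2 zz))// ltr_pdivrMr//
     ltr_pMr ?pi_gt0// ltr1n.
by rewrite asinK ?in_itv//= ltNge z0.
Qed.

(** The fundamental theorem of calculus for [- G]; the comparison with [s] is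
    only asked for inside the interval because the end points are negligible,
    and a curve that stays on the sphere for [0 <= t <= 1] is known to have
    velocity tangent to the sphere only there. *)
Lemma integral_ge_decrease (R : realType) (G G' s : R -> R) :
  (forall t : R, 0 <= t <= 1 -> is_derive t 1 G (G' t)) ->
  (forall t : R, 0 <= t <= 1 -> {for t, continuous G'}) ->
  continuous s ->
  (forall t : R, 0 < t < 1 -> - G' t <= s t) ->
  ((G 0 - G 1)%:E <=
    \int[@lebesgue_measure R]_(t in `[0%R, 1%R]) (s t)%:E)%E.
Proof.
move=> dG cG' cs le.
have cNG' : {within `[0, 1], continuous (- G')}.
  apply: continuous_in_subspaceT => t; rewrite inE/= in_itv/= => /cG' c.
  exact: continuousN.
have cG (t : R) : 0 <= t <= 1 -> {for t, continuous (- G)}.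
  move=> /dG[d _]; apply: continuousN.
  exact/differentiable_continuous/derivable1_diffP.
have FTC : (\int[@lebesgue_measure R]_(t in `[0%R, 1%R]) ((- G') t)%:E =
    ((- G) 1)%:E - ((- G) 0)%:E)%E.
  apply: continuous_FTC2 => //.
    split.
    - move=> t; rewrite in_itv/= => /andP[t0 t1]; apply: derivableN.
      by have [] := dG t _; rewrite ?ltW.
    - by apply: cvg_at_right_filter; apply: cG; rewrite lexx ler01.
    - by apply: cvg_at_left_filter; apply: cG; rewrite lexx ler01.
  move=> t; rewrite in_itv/= => /andP[t0 t1].
  have [d e] : is_derive t 1 G (G' t) by apply: dG; rewrite !ltW.
  by rewrite derive1E deriveN// e.
have -> : ((G 0 - G 1)%:E = ((- G) 1)%:E - ((- G) 0)%:E)%E.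
  by rewrite -EFinB; congr (_%:E); rewrite !fctE opprK addrC.
rewrite -FTC.
have i1 : (@lebesgue_measure R).-integrable `[0, 1] (EFin \o (- G')).
  by apply: continuous_compact_integrable => //; exact: segment_compact.
have i2 : (@lebesgue_measure R).-integrable `[0, 1] (EFin \o s).
  apply: continuous_compact_integrable; first exact: segment_compact.
  exact: continuous_subspaceT.
have sub : (`]0, 1[%classic : set R) `<=` `[0, 1]%classic by exact: subset_itv_oo_cc.
have j1 : (@lebesgue_measure R).-integrable `]0, 1[ (EFin \o (- G')).
  by apply: integrableS i1.
have j2 : (@lebesgue_measure R).-integrable `]0, 1[ (EFin \o s).
  by apply: integrableS i2.
rewrite [leLHS]integral_itv_bndoo; last by case/integrableP: j1.
rewrite [leRHS]integral_itv_bndoo; last by case/integrableP: j2.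
apply: le_integral => // t; rewrite inE/= in_itv/= => t01.
by rewrite lee_fin; exact: le.
Qed.

(** Along a curve of the sphere the angle [asin (dotp x (gam t))] changes no
    faster than arc length.  Scaling by [sin theta] keeps this property and
    keeps the argument of [asin] inside the interval where [asin] is
    differentiable.  The scaled angle starts at [theta] and ends at a
    nonpositive value. *)
Lemma curve_length_ge (R : realType) (k : nat) (x y : 'rV[R]_k.+1)
    (gam : R -> 'rV[R]_k.+1) (theta : R) :
  sphere_curve x y gam -> dotp x y <= 0 -> 0 < theta < pi / 2 ->
  (theta%:E <= curve_length gam)%E.
Proof.
case=> dgam cgam sgam gam0 gam1 xy /andP[th0 th1].
have xx : dotp x x = 1.
  by rewrite -gam0; have := sgam 0; rewrite lexx ler01 => /(_ isT).
pose gam' := derive1 gam.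
have Dgam (t : R) a : is_derive t 1 (fun t : R => gam t 0 a) (gam' t 0 a).
  split; first exact: ((derivable_mxP gam t 1).1 (dgam t) 0 a).
  by rewrite /gam' derive1E derive_mx// mxE.
have Cgam' (t : R) a : {for t, continuous (fun t : R => gam' t 0 a)}.
  by apply: (@continuous_comp _ _ _ gam' (fun M => M 0 a)); [exact: cgam|exact: coord_continuous].
pose u (t : R) : R := dotp x (gam t).
have Du (t : R) : is_derive t 1 u (dotp x (gam' t)).
  have := @is_derive_dotp R _ R (cst x) gam t 1 0 (gam' t)
    (fun a => _) (Dgam t).
  rewrite dot0p add0r; apply=> a.
  by rewrite mxE; exact: is_derive_cst.
have Cu (t : R) : {for t, continuous u}.
  have [d _] := Du t; exact/differentiable_continuous/derivable1_diffP.
have Cu' (t : R) : {for t, continuous (fun t : R => dotp x (gam' t))}.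
  by apply: continuous_dotp => // a; exact: cst_continuous.
have orth (t : R) : 0 < t < 1 -> dotp (gam t) (gam' t) = 0.
  move=> t01; have := is_derive_dotp (Dgam t) (Dgam t).
  case=> _.
  rewrite (@near_eq_derive R R R _ (cst (1 : R))); last first.
    near=> s; apply: sgam.
    have : s \in `]0, 1[ by near: s; apply: near_in_itvoo; rewrite in_itv.
    by rewrite in_itv/= => /andP[? ?]; rewrite !ltW.
  rewrite derive_cst (dotpC (gam' t)) => /esym; lra.
have u1 (t : R) : 0 <= t <= 1 -> u t ^+ 2 <= 1.
  by move=> /sgam st; have := dotp_CauchySchwarz x (gam t); rewrite xx st mulr1.
pose c := sin theta.
have c0 : 0 < c by rewrite /c sin_gt0_pihalf// th0.
have c1 : c < 1.
  have pi2 : 0 <= pi / 2 :> R by rewrite divr_ge0 ?pi_ge0.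
  by rewrite /c -[ltRHS]sin_pihalf ltr_sin ?in_itv//=; lra.
have cu (t : R) : 0 <= t <= 1 -> (c * u t) ^+ 2 < 1.
  by move=> /u1 ut; rewrite exprMn; nra.
have cu1 (t : R) : 0 <= t <= 1 -> -1 < c * u t < 1.
  by move=> /cu ut; apply/andP; split; nra.
pose w (t : R) : R := Num.sqrt (1 - (c * u t) ^+ 2).
have w0 (t : R) : 0 <= t <= 1 -> 0 < w t.
  by move=> /cu ut; rewrite sqrtr_gt0 subr_gt0.
pose G (t : R) : R := asin (c * u t).
pose G' (t : R) : R := (w t)^-1 * (c * dotp x (gam' t)).
have DG (t : R) : 0 <= t <= 1 -> is_derive t 1 G (G' t).
  move=> t01; apply: (@is_derive1_comp R asin (fun t : R => c * u t)).
    exact: is_derive1_asin (cu1 _ t01).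
have CG' (t : R) : 0 <= t <= 1 -> {for t, continuous G'}.
  move=> t01; apply: cvgM.
    apply: cvgV; first by rewrite gt_eqF// w0.
    apply: (@continuous_comp _ _ _ (fun t : R => 1 - (c * u t) ^+ 2) Num.sqrt).
      apply: cvgB; first exact: cvg_cst.
      by apply: cvgM; (apply: cvgM; [exact: cvg_cst|exact: Cu]).
    exact: sqrt_continuous.
  by apply: cvgM; [exact: cvg_cst|exact: Cu'].
have Cs : continuous (fun t : R => enorm (gam' t)).
  move=> t; apply: (@continuous_comp _ _ _ (fun t : R => dotp (gam' t) (gam' t)) Num.sqrt).
    exact: continuous_dotp.
  exact: sqrt_continuous.
have le (t : R) : 0 < t < 1 -> - G' t <= enorm (gam' t).
  move=> t01; have t01' : 0 <= t <= 1 by case/andP: t01 => *; rewrite !ltW.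
  (* up to sign, [v] is the component of [x] tangent to the sphere at [gam t] *)
  pose v := u t *: gam t - x.
  have vv : dotp v v = 1 - u t ^+ 2.
    rewrite /v !(dotpDl, dotpDr, dotpNl, dotpNr, dotpZl, dotpZr).
    have -> := sgam _ t01'; rewrite xx (dotpC (gam t)) -/(u t); ring.
  have -> : - G' t = (w t)^-1 * (c * dotp v (gam' t)).
    by rewrite /v /G' dotpDl dotpZl orth// dotpNl; ring.
  rewrite mulrC ler_pdivrMr ?w0//.
  have h1 := dotp_le_enorm v (gam' t).
  have h2 : c * enorm v <= w t.
    have ut := cu _ t01'.
    rewrite -ler_sqr ?nnegrE ?mulr_ge0 ?enorm_ge0 ?(ltW c0) ?sqrtr_ge0//.
    rewrite exprMn /enorm vv !sqr_sqrtr; last 2 first.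
    - by rewrite subr_ge0 ltW.
    - by rewrite subr_ge0 u1.
    by rewrite exprMn; nra.
  have h3 := enorm_ge0 (gam' t).
  rewrite [leRHS]mulrC; apply: le_trans (ler_wpM2r h3 h2).
  by rewrite -mulrA ler_wpM2l// ltW.
apply: le_trans (integral_ge_decrease DG CG' Cs le).
rewrite lee_fin /G /u gam0 gam1 xx mulr1 sinK; last first.
  by rewrite in_itv/= (ltW th1) andbT (le_trans _ (ltW th0))// oppr_le0 divr_ge0// pi_ge0.
rewrite lerDl oppr_ge0 asin_le0//.
have /andP[/ltW + _] := cu1 1 (introT andP (conj ler01 (lexx _))).
by rewrite /u gam1 => ->; rewrite pmulr_rle0.
Unshelve. all: by end_near. Qed.

(** The distance is an infimum of lengths that need not be attained; a curve
    shorter than the midpoint of [r] and [pi / 2] exists and suffices. *)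
Lemma geodesic_ball_dotp_gt0 (R : realType) (k : nat) (x y : 'rV[R]_k.+1)
    (r : R) :
  0 <= r -> r < pi / 2 -> geodesic_ball x r y -> 0 < dotp x y.
Proof.
move=> r0 rpi [_ dr]; rewrite ltNge; apply/negP => xy.
pose theta := (r + pi / 2) / 2.
have rth : r < theta by rewrite /theta; lra.
have th : 0 < theta < pi / 2 by rewrite (le_lt_trans r0 rth)/= /theta; lra.
have [|L [gam cgam <-]] := @ereal_inf_lt R
    [set curve_length gam | gam in sphere_curve x y] theta%:E.
  by rewrite (le_lt_trans dr)// lte_fin.
by rewrite ltNge (curve_length_ge cgam xy th).
Qed.

(** * Vector-valued bilinear forms and Otsuki's lemma *)

Section VectorForms.
Variables (R : realType) (m N : nat) (A : 'I_N -> 'M[R]_m).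
Implicit Types u v w : 'rV[R]_m.

(** A bilinear map into ['rV_N] is encoded by the Gram matrices of its
    coordinates, so that symmetry is a condition on matrices. *)
Definition vform u v : 'rV[R]_N := \row_a dotp (u *m A a) v.

Lemma vformDl u v w : vform (u + v) w = vform u w + vform v w.
Proof. by apply/rowP => a; rewrite !mxE mulmxDl dotpDl. Qed.

Lemma vformDr u v w : vform u (v + w) = vform u v + vform u w.
Proof. by apply/rowP => a; rewrite !mxE dotpDr. Qed.

Lemma vformZl c u v : vform (c *: u) v = c *: vform u v.
Proof. by apply/rowP => a; rewrite !mxE -scalemxAl dotpZl. Qed.

Lemma vformZr c u v : vform u (c *: v) = c *: vform u v.
Proof. by apply/rowP => a; rewrite !mxE dotpZr. Qed.

(** Turns a partially applied form into a matrix, whose kernel can be counted by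
    rank. *)
Lemma vform_mulmx u v :
  vform u v = v *m (\matrix_(i, a) (u *m A a) 0 i).
Proof.
apply/rowP => a; rewrite !mxE; apply: eq_bigr => i _.
by rewrite [in RHS]mxE mulrC.
Qed.

Lemma vformC : (forall a, (A a)^T = A a) -> forall u v, vform u v = vform v u.
Proof.
move=> sA u v; apply/rowP => a; rewrite !mxE dotpC !dotpE.
by rewrite trmx_mul sA mulmxA.
Qed.

End VectorForms.

Lemma continuous_mulmx_coord (R : realType) (m N : nat) (J : 'M[R]_(m, N)) a u :
  {for u, continuous (fun v : 'rV[R]_m => (v *m J) 0 a)}.
Proof.
have -> : (fun v : 'rV[R]_m => (v *m J) 0 a) = (fun v => dotp v (col a J)^T).
  by apply/funext => v; rewrite mxE; apply: eq_bigr => i _; rewrite !mxE.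
apply: continuous_dotp => b; first exact: coord_continuous.
exact: cst_continuous.
Qed.

Lemma continuous_vform_coord (R : realType) (m N : nat) (A : 'I_N -> 'M[R]_m)
  a u : {for u, continuous (fun v : 'rV[R]_m => vform A v v 0 a)}.
Proof.
have -> : (fun v : 'rV[R]_m => vform A v v 0 a) = (fun v => dotp (v *m A a) v).
  by apply/funext => v; rewrite mxE.
apply: continuous_dotp => b; first exact: continuous_mulmx_coord.
exact: coord_continuous.
Qed.

(** For [x < 0] the choice [t = - x / (C - x)] contradicts the bound. *)
Lemma ge0_of_small_lower_bounds (R : realType) (x C : R) :
  0 <= C -> (forall t, 0 < t <= 1 -> - (t * C) <= x) -> 0 <= x.
Proof.
move=> C0 H; rewrite leNgt; apply/negP => x0.
have d0 : 0 < C - x by rewrite subr_gt0 (lt_le_trans x0).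
have := H (- x / (C - x)); rewrite divr_gt0 ?oppr_gt0//= => /(_ _).
rewrite ler_pdivrMr// mul1r lerDr C0 => /(_ isT).
rewrite -subr_ge0.
have -> : x - - (- x / (C - x) * C) = - x ^+ 2 / (- (C - x)) * -1.
  by field; rewrite gt_eqF.
have x2 : 0 < x ^+ 2 / (C - x).
  by rewrite divr_gt0// exprn_even_gt0//= lt_eqF.
by rewrite invrN mulrNN mulrN1 oppr_ge0 leNgt x2.
Qed.

(** First and second order conditions at a minimum, for a polynomial of degree
    four without constant term: the lowest order term dominates near 0. *)
Lemma quartic_ge0_coef (R : realType) (c1 c2 c3 c4 : R) :
  (forall t, 0 <= c1 * t + c2 * t ^+ 2 + c3 * t ^+ 3 + c4 * t ^+ 4) ->
  c1 = 0 /\ 0 <= c2.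
Proof.
move=> H; pose C := `|c2| + `|c3| + `|c4|.
have C0 : 0 <= C by rewrite /C !addr_ge0.
have P (c s : R) : `|s| <= 1 -> 0 <= `|c| - c * s.
  move=> s1; rewrite subr_ge0 (le_trans (ler_norm _))// normrM.
  by rewrite -[leRHS]mulr1 ler_wpM2l.
have P0 (c : R) : 0 <= `|c| - c by have := P c 1; rewrite normr1 mulr1; exact.
have T01 (t : R) : 0 < t -> t <= 1 -> [/\ `|t| <= 1, `|- t| <= 1 & `|t ^+ 2| <= 1].
  move=> t0 t1; have t1' : `|t| <= 1 by rewrite gtr0_norm.
  by rewrite normrN normrX exprn_ile1.
have c1E : c1 = 0.
  apply/eqP; rewrite eq_le; apply/andP; split.
    rewrite -oppr_ge0; apply: (ge0_of_small_lower_bounds C0) => t /andP[t0 t1].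
    rewrite -(ler_pM2l t0) -subr_ge0.
    apply: le_trans (H (- t)) _; rewrite -subr_ge0.
    have -> : t * - c1 - t * - (t * C) -
     (c1 * - t + c2 * (- t) ^+ 2 + c3 * (- t) ^+ 3 + c4 * (- t) ^+ 4) =
     t ^+ 2 * ((`|c2| - c2) + (`|c3| - c3 * - t) + (`|c4| - c4 * t ^+ 2)).
      by rewrite /C; ring.
    have [? ? ?] := T01 _ t0 t1; apply: mulr_ge0; rewrite ?sqr_ge0//.
    by apply: addr_ge0; [apply: addr_ge0|]; rewrite ?P0 ?P.
  apply: (ge0_of_small_lower_bounds C0) => t /andP[t0 t1].
  rewrite -(ler_pM2l t0) -subr_ge0.
  apply: le_trans (H t) _; rewrite -subr_ge0.
  have -> : t * c1 - t * - (t * C) -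
     (c1 * t + c2 * t ^+ 2 + c3 * t ^+ 3 + c4 * t ^+ 4) =
     t ^+ 2 * ((`|c2| - c2) + (`|c3| - c3 * t) + (`|c4| - c4 * t ^+ 2)).
    by rewrite /C; ring.
  have [? ? ?] := T01 _ t0 t1; apply: mulr_ge0; rewrite ?sqr_ge0//.
  by apply: addr_ge0; [apply: addr_ge0|]; rewrite ?P0 ?P.
split=> //; apply: (ge0_of_small_lower_bounds C0) => t /andP[t0 t1].
have t2 : 0 < t ^+ 2 by rewrite exprn_gt0.
rewrite -(ler_pM2l t2) -subr_ge0.
apply: le_trans (H t) _; rewrite -subr_ge0 c1E.
have -> : t ^+ 2 * c2 - t ^+ 2 * - (t * C) -
     (0 * t + c2 * t ^+ 2 + c3 * t ^+ 3 + c4 * t ^+ 4) =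
     t ^+ 3 * (`|c2| + (`|c3| - c3) + (`|c4| - c4 * t)).
  by rewrite /C; ring.
have [? ? ?] := T01 _ t0 t1; apply: mulr_ge0; rewrite ?exprn_ge0 ?(ltW t0)//.
by apply: addr_ge0; [apply: addr_ge0|]; rewrite ?P0 ?P.
Qed.

(** The two spaces of Otsuki's lemma are given by equations and by a basis: the
    domain is the kernel of [L] in ['rV_m] with the inner product pulled back
    by the injective [J], and the values of the form are orthogonal to the [q]
    independent rows of [S]. *)
Section Otsuki.
Variables (R : realType) (m l N q : nat).
Variables (L : 'M[R]_(m, l)) (J : 'M[R]_(m, N)) (S : 'M[R]_(q, N)).
Variable A : 'I_N -> 'M[R]_m.
Hypothesis A_sym : forall a, (A a)^T = A a.
Hypothesis J_free : row_free J.
Hypothesis S_free : row_free S.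
Hypothesis A_normal : forall u v, u *m L = 0 -> v *m L = 0 ->
  vform A u v *m S^T = 0.
Hypothesis A_neq0 : forall u, u *m L = 0 -> u != 0 -> vform A u u != 0.
Hypothesis dim : (l + N < m + q)%N.

Local Notation g u v := (dotp (u *m J) (v *m J)).
Local Notation sqvform u := (dotp (vform A u u) (vform A u u)).

Let g_gt0 (u : 'rV[R]_m) : u != 0 -> 0 < g u u.
Proof.
move=> u0; rewrite dotp_gt0; apply: contra u0 => /eqP uJ.
by apply/eqP/(row_free_inj J_free); rewrite uJ mul0mx.
Qed.

(** The quotient is homogeneous of degree 0, so its minimum over the compact unit
    sphere of the sup norm is its minimum over all nonzero vectors of the
    kernel. *)
Lemma otsuki_minimizer : exists x : 'rV[R]_m, [/\ x *m L = 0, x != 0 &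
  forall u, u *m L = 0 -> sqvform x / g x x ^+ 2 * g u u ^+ 2 <= sqvform u].
Proof.
have lm : (l < m)%N.
  have : (q <= N)%N by rewrite -(eqP S_free) rank_leq_col.
  by move: dim; lia.
pose D := [set u : 'rV[R]_m | `|u| = 1 /\ u *m L = 0].
have norm1 (u : 'rV[R]_m) : u != 0 -> `| `|u|^-1 *: u | = 1.
  by move=> u0; rewrite normrZ normfV normr_id mulVf// normr_eq0.
have D0 : D !=set0.
  have /rowV0Pn[u /sub_kermxP uL u0] : kermx L != 0.
    rewrite -mxrank_eq0 mxrank_ker -lt0n subn_gt0.
    by rewrite (leq_ltn_trans (rank_leq_col L)).
  exists (`|u|^-1 *: u); split; first exact: norm1.
  by rewrite -scalemxAl uL scaler0.
have Dc : compact D.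
  apply: bounded_closed_compact.
    exists 1; split; first exact: num_real.
    by move=> y y1 u [u1 _]; rewrite /= u1 ltW.
  have -> : D = (fun u : 'rV[R]_m => `|u|) @^-1` [set 1] `&`
      \bigcap_(a in [set: 'I_l]) (fun u => (u *m L) 0 a) @^-1` [set 0].
    apply/seteqP; split => u [u1 uL]; split => //.
      by move=> a _ /=; rewrite uL mxE.
    by apply/rowP => a; rewrite [RHS]mxE; exact: (uL a I).
  apply: closedI.
    apply: preimage_closed; last exact: closed_eq.
    by move=> u _; exact: norm_continuous.
  apply: closed_bigI => a _; apply: preimage_closed; last exact: closed_eq.
  by move=> u _; exact: continuous_mulmx_coord.
have Dn0 u : D u -> u != 0.
  by case=> u1 _; rewrite -normr_eq0 u1 oner_eq0.
have [|x xD xmin] := @compact_EVT_min _ R (fun u : 'rV[R]_m => sqvform u / g u u ^+ 2) D D0 Dc _.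
  apply: continuous_in_subspaceT => u; rewrite inE => /Dn0 u0.
  have cg : {for u, continuous (fun u : 'rV[R]_m => g u u)}.
    by apply: continuous_dotp => a; exact: continuous_mulmx_coord.
  have ca : {for u, continuous (fun u : 'rV[R]_m => sqvform u)}.
    by apply: continuous_dotp => a; exact: continuous_vform_coord.
  apply: (continuousM ca); apply: continuousV.
    by rewrite gt_eqF// exprn_gt0// g_gt0.
  exact: (continuousM cg cg).
rewrite inE in xD; exists x; split; [by case: xD|exact: Dn0|].
move=> u uL; have [->|u0] := eqVneq u 0.
  by rewrite mul0mx dot0p expr0n mulr0 dotp_ge0.
have := xmin (`|u|^-1 *: u).
rewrite inE => /(_ _)/wrap[]; first by split; [exact: norm1|rewrite -scalemxAl uL scaler0].
have nu : `|u| != 0 by rewrite normr_eq0.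
rewrite -scalemxAl !(vformZl, vformZr, dotpZl, dotpZr) -/(g u u).
have gu := g_gt0 u0.
have -> : forall p q' r : R, p != 0 -> r != 0 ->
    p * (p * (p * (p * q'))) / (p * (p * r)) ^+ 2 = q' / r ^+ 2.
  by move=> p q' r p0 r0; field; rewrite p0 r0.
- by rewrite ler_pdivlMr// exprn_gt0.
- by rewrite invr_eq0.
- by rewrite gt_eqF.
Qed.

(** For a minimiser [x] of the quotient, with minimum [lam], the quartic
    polynomial in [t]
    obtained from [sqvform - lam * g ^+ 2] at [x + t *: y] is nonnegative and
    vanishes at [t = 0]; its coefficients of degree one and two give [crit].
    The space [K] of the admissible directions [y] has dimension at least
    [m - l - 1], and [y |-> vform A x y] maps [K] into the orthogonal
    complement of the rows of [T], of dimension [N - q - 1]; by [dim] this map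
    has a kernel on [K]. *)
Lemma otsuki : exists u v : 'rV[R]_m,
  [/\ u *m L = 0 /\ u != 0, v *m L = 0 /\ v != 0, g u v = 0, vform A u v = 0 &
      0 < dotp (vform A u u) (vform A v v)].
Proof.
have [x [xL x0 xmin]] := otsuki_minimizer.
set lam := sqvform x / g x x ^+ 2 in xmin.
have gx := g_gt0 x0.
have lam0 : 0 < lam.
  by rewrite divr_gt0 ?exprn_gt0// dotp_gt0 A_neq0.
have ax : sqvform x = lam * g x x ^+ 2 by rewrite divfK// gt_eqF// exprn_gt0.
have crit y : y *m L = 0 -> g x y = 0 ->
    dotp (vform A x x) (vform A x y) = 0 /\
    0 <= 4 * dotp (vform A x y) (vform A x y) +
         2 * dotp (vform A x x) (vform A y y) - 2 * lam * g x x * g y y.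
  move=> yL gxy.
  set a := vform A x x; set b := vform A x y; set c := vform A y y.
  have [|c1 c2] := @quartic_ge0_coef R (4 * dotp a b)
    (4 * dotp b b + 2 * dotp a c - 2 * lam * g x x * g y y)
    (4 * dotp b c) (dotp c c - lam * g y y ^+ 2).
    move=> t; have := xmin (x + t *: y).
    rewrite mulmxDl -scalemxAl xL yL scaler0 addr0 => /(_ erefl).
    rewrite -subr_ge0 !(vformDl, vformDr, vformZl, vformZr).
    rewrite (vformC A_sym y x) -/a -/b -/c.
    rewrite !(dotpDl, dotpDr, dotpZl, dotpZr) (dotpC b a) (dotpC c a) (dotpC c b).
    have -> : g (x + t *: y) (x + t *: y) = g x x + t ^+ 2 * g y y.
      rewrite !mulmxDl -scalemxAl !(dotpDl, dotpDr, dotpZl, dotpZr).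
      by rewrite (dotpC (y *m J)) -/(g x y) gxy -/(g x x) -/(g y y); ring.
    have ax' : dotp a a = lam * g x x ^+ 2 by exact: ax.
    by rewrite ax'; congr (_ <= _); ring.
  by split=> //; lra.
pose a := vform A x x.
pose M : 'M[R]_(m, N) := \matrix_(i, b) (x *m A b) 0 i.
pose c : 'M[R]_(m, 1) := J *m (x *m J)^T.
pose K := kermx (row_mx L c).
have KP (y : 'rV[R]_m) : (y <= K)%MS -> y *m L = 0 /\ g x y = 0.
  move=> /sub_kermxP; rewrite mul_mx_row -[0]row_mx0 => /eq_row_mx[-> yc].
  by split=> //; rewrite dotpC dotpE -mulmxA -/c yc mxE.
pose T := col_mx S a.
have T_free : \rank T = (q + 1)%N.
  apply/eqP; apply: inj_row_free => v.
  have aS : S *m a^T = 0.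
    by rewrite -[S]trmxK -trmx_mul A_normal// trmx0.
  rewrite -[v]hsubmxK mul_row_col => E.
  have v2 : rsubmx v = 0.
    have : (lsubmx v *m S + rsubmx v *m a) *m a^T = 0 by rewrite E mul0mx.
    rewrite mulmxDl -!mulmxA aS mulmx0 add0r => /rowP/(_ 0).
    rewrite [RHS]mxE mxE big_ord1 -dotpE => /eqP.
    rewrite mulf_eq0 dotp_eq0 (negPf (A_neq0 xL x0)) orbF => /eqP v0.
    by apply/rowP => i; rewrite ord1 v0 mxE.
  move: E; rewrite v2 mul0mx addr0 => E.
  by rewrite (row_free_inj S_free (etrans E (esym (mul0mx _ _)))) row_mx0.
have KMT : K *m M *m T^T = 0.
  apply/row_matrixP => i; rewrite row0 row_mul (row_mul i K M).
  have /KP[yL gxy] := row_sub i K.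
  rewrite -vform_mulmx tr_col_mx mul_mx_row A_normal//.
   have -> : vform A x (row i K) *m a^T = 0.
    apply/rowP => j; rewrite ord1 -dotpE mxE dotpC.
    by have [] := crit _ yL gxy.
  by rewrite row_mx0.
have r1 : (\rank (K *m M) + (q + 1) <= N)%N.
  have := mulmx0_rank_max KMT; by rewrite mxrank_tr T_free.
have r2 : (m - (l + 1) <= \rank K)%N.
  rewrite /K mxrank_ker leq_sub2l//; exact: rank_leq_col.
have : (K :&: kermx M)%MS != 0.
  rewrite -mxrank_eq0 -lt0n; have := mxrank_mul_ker K M.
  by move: dim r1 r2; lia.
case/rowV0Pn => y; rewrite sub_capmx => /andP[/KP[yL gxy] /sub_kermxP yM] y0.
have b0 : vform A x y = 0 by rewrite vform_mulmx.
exists x, y; split => //.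
have [_] := crit _ yL gxy; rewrite b0 dotp0 mulr0 add0r => h.
have gy := g_gt0 y0.
have : 0 < lam * g x x * g y y by apply: mulr_gt0 gy; apply: mulr_gt0 gx.
lra.
Qed.
End Otsuki.


(** * Calculus of smooth maps on an open set *)

Section Smooth.
Variables (R : realType) (m : nat) (U : set 'rV[R]_m).
Hypothesis U_open : open U.
Implicit Types (f : 'rV[R]_m -> R) (x : 'rV[R]_m).

Lemma smooth_derivable f x i : smooth_on U f -> U x ->
  derivable f x (delta_mx 0 i).
Proof. by move=> sf Ux; have [_] := sf [::] x Ux; exact. Qed.

Lemma smooth_continuous f x : smooth_on U f -> U x -> {for x, continuous f}.
Proof. by move=> sf Ux; have [] := sf [::] x Ux. Qed.

Lemma smooth_partial f i : smooth_on U f -> smooth_on U (partial i f).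
Proof.
by move=> sf s x Ux; have := sf (rcons s i) x Ux; rewrite /iter_partial foldr_rcons.
Qed.

Lemma open_near x : U x -> \forall y \near x, U y.
Proof. by move=> Ux; exact: open_nbhs_nbhs. Qed.

Lemma smooth_is_derive f x u : smooth_on U f -> U x ->
  is_derive x u f (\sum_i u 0 i * partial i f x).
Proof.
move=> sf Ux; apply: is_derive_partials => i.
  by apply: filterS (open_near Ux) => y; exact: smooth_derivable.
by apply: smooth_continuous Ux; exact: smooth_partial.
Qed.

Lemma smooth_partialC f x i j : smooth_on U f -> U x ->
  partial i (partial j f) x = partial j (partial i f) x.
Proof.
move=> sf Ux; apply: derive_sym.
- apply: filterS (open_near Ux) => y Uy; split.
  + exact: smooth_derivable.
  + by apply: smooth_derivable Uy; exact: smooth_partial.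
  + exact: smooth_derivable.
  + by apply: smooth_derivable Uy; exact: smooth_partial.
- by apply: smooth_continuous Ux; do 2 apply: smooth_partial.
- by apply: smooth_continuous Ux; do 2 apply: smooth_partial.
Qed.

Lemma partial_near f f' x i : U x -> (forall y, U y -> f y = f' y) ->
  partial i f x = partial i f' x.
Proof.
by move=> Ux H; apply: near_eq_derive; apply: filterS (open_near Ux).
Qed.

Section Vector.
Variable N : nat.
Implicit Types G H : 'rV[R]_m -> 'rV[R]_N.

Definition vpartial (i : 'I_m) G x : 'rV[R]_N :=
  \row_a partial i (fun y => G y 0 a) x.

Lemma vpartialE i G a : (fun y => vpartial i G y 0 a) =
  partial i (fun y => G y 0 a).
Proof. by apply/funext => y; rewrite mxE. Qed.

Lemma smooth_vpartial i G : smooth_map_on U G -> smooth_map_on U (vpartial i G).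
Proof. by move=> sG a; rewrite vpartialE; exact: smooth_partial. Qed.

Lemma is_derive_vpartial i G x a : smooth_map_on U G -> U x ->
  is_derive x (delta_mx 0 i) (fun y => G y 0 a) (vpartial i G x 0 a).
Proof.
move=> sG Ux; rewrite mxE; apply: derivableP.
exact: (smooth_derivable (sG a) Ux).
Qed.

Lemma is_derive_dotp_smooth i G H x : smooth_map_on U G -> smooth_map_on U H ->
  U x -> is_derive x (delta_mx 0 i) (fun y => dotp (G y) (H y))
    (dotp (vpartial i G x) (H x) + dotp (G x) (vpartial i H x)).
Proof.
by move=> sG sH Ux; apply: is_derive_dotp => a; exact: is_derive_vpartial.
Qed.

Lemma partial_dotp i G H x : smooth_map_on U G -> smooth_map_on U H -> U x ->
  partial i (fun y => dotp (G y) (H y)) x =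
  dotp (vpartial i G x) (H x) + dotp (G x) (vpartial i H x).
Proof.
by move=> sG sH Ux; have [_] := is_derive_dotp_smooth i sG sH Ux.
Qed.

Lemma vpartialC i j G x : smooth_map_on U G -> U x ->
  vpartial i (vpartial j G) x = vpartial j (vpartial i G) x.
Proof.
move=> sG Ux; apply/rowP => a.
by rewrite [LHS]mxE [RHS]mxE !vpartialE (smooth_partialC _ _ (sG a)).
Qed.

Lemma row_jac i G x : row i (jac G x) = vpartial i G x.
Proof. by apply/rowP => a; rewrite !mxE. Qed.

Lemma mulmx_jac u G x : u *m jac G x = \sum_i u 0 i *: vpartial i G x.
Proof. by rewrite mulmx_sum_row; apply: eq_bigr => i _; rewrite row_jac. Qed.

End Vector.
End Smooth.

(** * The Gauss equation *)

Section DerivableMatrix.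
Variables (R : realType) (V : normedModType R) (x v : V).

Lemma derivable_bigsum (I : Type) (r : seq I) (f : I -> V -> R) :
  (forall i, derivable (f i) x v) ->
  derivable (fun y => \sum_(i <- r) f i y) x v.
Proof.
move=> df; elim: r => [|i r IH].
  by under eq_fun do rewrite big_nil; exact: derivable_cst.
by under eq_fun do rewrite big_cons; apply: derivableD.
Qed.

Lemma derivable_bigprod (I : Type) (r : seq I) (f : I -> V -> R) :
  (forall i, derivable (f i) x v) ->
  derivable (fun y => \prod_(i <- r) f i y) x v.
Proof.
move=> df; elim: r => [|i r IH].
  by under eq_fun do rewrite big_nil; exact: derivable_cst.
by under eq_fun do rewrite big_cons; apply: derivableM.
Qed.

Lemma derivable_det (n : nat) (A : V -> 'M[R]_n) :
  (forall i j, derivable (fun y => A y i j) x v) ->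
  derivable (fun y => \det (A y)) x v.
Proof.
move=> dA; apply: derivable_bigsum => s; apply: derivableM.
  exact: derivable_cst.
by apply: derivable_bigprod => i; exact: dA.
Qed.

(** Near [x] the inverse is given by Cramer's rule. *)
Lemma derivable_invmx (n : nat) (A : V -> 'M[R]_n) i j :
  (\forall y \near x, A y \in unitmx) ->
  (forall i j, derivable (fun y => A y i j) x v) ->
  derivable (fun y => invmx (A y) i j) x v.
Proof.
move=> uA dA.
have H : \near x, (\det (A x))^-1 * cofactor (A x) j i = invmx (A x) i j.
  by apply: filterS uA => y uy; rewrite /invmx uy !mxE.
apply: near_eq_derivable H _; apply: derivableM.
  apply: derivableV; last exact: derivable_det.
  by have := nbhs_singleton uA; rewrite unitmxE unitfE.
apply: derivableM; first exact: derivable_cst.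
apply: derivable_det => a b.
by under eq_fun do rewrite !mxE; exact: dA.
Qed.
End DerivableMatrix.

(** The algebra behind the Gauss equation.  With the index [l] lowered by the
    metric [h], the four kinds of terms of the curvature tensor of an immersion
    [F] are as follows: [Ri], [Rj] the derivatives of Christoffel symbols; [t] the third
    derivatives of [F], which cancel by symmetry; [Li], [Lj] the lowered
    Christoffel symbols, whose products with [Gjk], [Gik] cancel as well; [a],
    [b], [Ni], [Nj] the products of second derivatives, which remain. *)
Lemma gauss_algebra (R : comNzRingType) (n : nat)
    (Ri Rj Gjk Gik h Li Lj Ni Nj : 'I_n -> R) (Gi Gj : 'I_n -> 'I_n -> R)
    (t a b : R) :
  \sum_s Ri s * h s = t + a - \sum_p Gjk p * (Li p + Ni p) ->
  \sum_s Rj s * h s = t + b - \sum_p Gik p * (Lj p + Nj p) ->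
  (forall p, \sum_s Gi s p * h s = Li p) ->
  (forall p, \sum_s Gj s p * h s = Lj p) ->
  \sum_s (Ri s - Rj s + \sum_p (Gi s p * Gjk p - Gj s p * Gik p)) * h s =
  a - \sum_p Gjk p * Ni p - (b - \sum_p Gik p * Nj p).
Proof.
move=> Hi Hj HLi HLj.
have C (G : 'I_n -> 'I_n -> R) (c L : 'I_n -> R) :
    (forall p, \sum_s G s p * h s = L p) ->
    \sum_s (\sum_p G s p * c p) * h s = \sum_p c p * L p.
  move=> HL; under eq_bigr do rewrite mulr_suml.
  rewrite exchange_big; apply: eq_bigr => p _.
  by rewrite -HL mulr_sumr; apply: eq_bigr => s _; rewrite mulrAC mulrC.
under eq_bigr do rewrite sumrB mulrDl !mulrBl.
rewrite big_split !sumrB /= Hi Hj (C _ _ _ HLi) (C _ _ _ HLj).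
have S (c L N : 'I_n -> R) :
    \sum_p c p * (L p + N p) = \sum_p c p * L p + \sum_p c p * N p.
  by rewrite -big_split; apply: eq_bigr => p _; rewrite mulrDr.
by rewrite !S; ring.
Qed.

(** The indices are contracted one at a time, from the inside outwards, each
    step using linearity of [dotp] in one argument. *)
Lemma curvature_contract (R : realType) (n N : nat)
    (r : 'I_n -> 'I_n -> 'I_n -> 'I_n -> R) (h : 'M[R]_n)
    (B : 'I_n -> 'I_n -> 'rV[R]_N) (u v : 'rV[R]_n) :
  (forall i j k q, \sum_l r l k i j * h l q =
    dotp (B j k) (B i q) - dotp (B i k) (B j q)) ->
  let Q x y := \sum_i x 0 i *: \sum_j y 0 j *: B i j in
  ((\row_l \sum_i \sum_j \sum_k r l k i j * u 0 i * v 0 j * v 0 k)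
     *m h *m u^T) 0 0 =
  dotp (Q v v) (Q u u) - dotp (Q v u) (Q u v).
Proof.
move=> H Q.
have lin (c : 'I_n -> R) (a d : 'rV[R]_N) (b e : 'I_n -> 'rV[R]_N) :
    \sum_q c q * (dotp a (b q) - dotp d (e q)) =
    dotp a (\sum_q c q *: b q) - dotp d (\sum_q c q *: e q).
  rewrite !dotp_sumr -sumrB; apply: eq_bigr => q _.
  by rewrite mulrBr !dotpZr.
pose Bu i := \sum_q u 0 q *: B i q.
pose Bv i := \sum_q v 0 q *: B i q.
have E1 i j k : \sum_l r l k i j * (h *m u^T) l 0 =
    dotp (Bu i) (B j k) - dotp (Bu j) (B i k).
  rewrite (dotpC (Bu i)) (dotpC (Bu j)) -lin.
  under [RHS]eq_bigr do rewrite -H mulr_sumr.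
  rewrite exchange_big /=; apply: eq_bigr => l _.
  rewrite mxE mulr_sumr; apply: eq_bigr => q _.
  by rewrite mxE; ring.
have E2 i j : \sum_k v 0 k * (\sum_l r l k i j * (h *m u^T) l 0) =
    dotp (Bu i) (Bv j) - dotp (Bv i) (Bu j).
  by rewrite (dotpC (Bv i)) -lin; apply: eq_bigr => k _; rewrite E1.
have E3 i : \sum_j v 0 j * (dotp (Bu i) (Bv j) - dotp (Bv i) (Bu j)) =
    dotp (Q v v) (Bu i) - dotp (Q v u) (Bv i).
  by rewrite lin (dotpC (Bu i)) (dotpC (Bv i)).
rewrite /Q -lin -mulmxA mxE.
under eq_bigr do rewrite mxE mulr_suml.
rewrite exchange_big /=; apply: eq_bigr => i _; rewrite -E3.
under eq_bigr do rewrite mulr_suml.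
rewrite exchange_big /= mulr_sumr; apply: eq_bigr => j _; rewrite -E2.
under eq_bigr do rewrite mulr_suml.
rewrite exchange_big /= !mulr_sumr; apply: eq_bigr => k _.
by rewrite !mulr_sumr; apply: eq_bigr => l _; ring.
Qed.

Section Gauss.
Variables (R : realType) (m N : nat) (U : set 'rV[R]_m).
Variables (F : 'rV[R]_m -> 'rV[R]_N) (g : 'rV[R]_m -> 'M[R]_m).
Hypothesis U_open : open U.
Hypothesis F_smooth : smooth_map_on U F.
Hypothesis F_imm : forall y, U y -> row_free (jac F y).
Hypothesis F_isom : forall y, U y -> g y = jac F y *m (jac F y)^T.

Local Notation D i := (vpartial i F).
Local Notation DD i j := (vpartial i (vpartial j F)).
Let sD i : smooth_map_on U (D i).
Proof. exact: smooth_vpartial. Qed.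

Let sDD i j : smooth_map_on U (DD i j).
Proof. exact: smooth_vpartial. Qed.

Lemma gramE i j y : U y -> g y i j = dotp (D i y) (D j y).
Proof.
move=> Uy; rewrite F_isom// mxE; apply: eq_bigr => a _.
by rewrite -!row_jac !mxE.
Qed.

Lemma gramC i j y : U y -> g y i j = g y j i.
Proof. by move=> Uy; rewrite (gramE i j Uy) (gramE j i Uy) dotpC. Qed.

Lemma gram_unit y : U y -> g y \in unitmx.
Proof.
move=> Uy; rewrite -row_free_unit; apply: inj_row_free => v vg.
have : dotp (v *m jac F y) (v *m jac F y) = 0.
  by rewrite dotpE trmx_mul mulmxA -(mulmxA v) -F_isom// vg mul0mx mxE.
move=> /eqP; rewrite dotp_eq0 => /eqP vJ.
by apply: (row_free_inj (F_imm Uy)); rewrite vJ mul0mx.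
Qed.

Lemma partial_gram i j k y : U y -> partial i (fun z => g z j k) y =
  dotp (DD i j y) (D k y) + dotp (D j y) (DD i k y).
Proof.
move=> Uy; rewrite (partial_near U_open (f' := fun z => dotp (D j z) (D k z)))//.
  exact: (partial_dotp i (sD j) (sD k) Uy).
by move=> z Uz; rewrite gramE.
Qed.

Lemma christoffelE k i j y : U y -> christoffel g k i j y =
  \sum_l invmx (g y) k l * dotp (DD i j y) (D l y).
Proof.
move=> Uy; rewrite /christoffel mulr_sumr; apply: eq_bigr => l _.
rewrite !partial_gram// (vpartialC U_open j i F_smooth Uy : DD j i y = DD i j y).
rewrite (vpartialC U_open l i F_smooth Uy : DD l i y = DD i l y).
rewrite (vpartialC U_open l j F_smooth Uy : DD l j y = DD j l y).
by rewrite !(dotpC (D _ _)); field.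
Qed.

(** [christoffel g k i j] is the [k]-th coordinate of the tangential part of the
    second derivative [DD i j] in the basis of the [D k]. *)
Lemma christoffel_lower i j l y : U y ->
  \sum_k christoffel g k i j y * g y k l = dotp (DD i j y) (D l y).
Proof.
move=> Uy.
under eq_bigr do rewrite christoffelE// mulr_suml.
rewrite exchange_big /= (bigD1 l)//= [X in _ + X]big1 => [|s sl].
  rewrite addr0; under eq_bigr do rewrite mulrAC.
  rewrite -mulr_suml.
  have -> : \sum_k invmx (g y) k l * g y k l = (g y *m invmx (g y)) l l.
    rewrite mxE; apply: eq_bigr => k _.
    by rewrite mulrC (gramC k l Uy).
  by rewrite mulmxV ?gram_unit// mxE eqxx mul1r.
under eq_bigr do rewrite mulrAC.
rewrite -mulr_suml.
have -> : \sum_k invmx (g y) k s * g y k l = (g y *m invmx (g y)) l s.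
  rewrite mxE; apply: eq_bigr => k _.
  by rewrite mulrC (gramC k l Uy).
by rewrite mulmxV ?gram_unit// mxE eq_sym (negPf sl) mul0r.
Qed.

Lemma derivable_christoffel k i j a y : U y ->
  derivable (christoffel g k i j) y (delta_mx 0 a).
Proof.
move=> Uy.
have H : \near y, \sum_l invmx (g y) k l * dotp (DD i j y) (D l y) =
    christoffel g k i j y.
  by apply: filterS (open_near U_open Uy) => z Uz; rewrite christoffelE.
apply: near_eq_derivable H _; apply: derivable_bigsum => l.
apply: derivableM.
  apply: derivable_invmx.
    by apply: filterS (open_near U_open Uy) => z; exact: gram_unit.
  move=> b c.
  have H : \near y, dotp (D b y) (D c y) = g y b c.
    by apply: filterS (open_near U_open Uy) => z Uz; rewrite gramE.
  apply: near_eq_derivable H _.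
  by have [] := is_derive_dotp_smooth a (sD b) (sD c) Uy.
by have [] := is_derive_dotp_smooth a (sDD i j) (sD l) Uy.
Qed.

(** The second fundamental form of the immersion [F] in Euclidean space: the sum
    is the tangential part of the second derivative. *)
Definition sff (i j : 'I_m) y :=
  DD i j y - \sum_p christoffel g p i j y *: D p y.

Lemma sff_normal i j l y : U y -> dotp (sff i j y) (D l y) = 0.
Proof.
move=> Uy; rewrite dotpDl dotpNl dotp_suml -christoffel_lower//.
apply/eqP; rewrite subr_eq0; apply/eqP/eq_bigr => k _.
by rewrite dotpZl gramE.
Qed.

Lemma sffC i j y : U y -> sff i j y = sff j i y.
Proof.
move=> Uy; rewrite /sff (vpartialC U_open i j F_smooth Uy : DD i j y = DD j i y).
congr (_ - _); apply: eq_bigr => p _.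
rewrite (christoffelE p i j Uy) (christoffelE p j i Uy).
by rewrite (vpartialC U_open i j F_smooth Uy : DD i j y = DD j i y).
Qed.

(** The identity [christoffel_lower] differentiated in the direction [i]. *)
Lemma partial_christoffel_lower i j k l y : U y ->
  \sum_p partial i (christoffel g p j k) y * g y p l =
  dotp (vpartial i (DD j k) y) (D l y) + dotp (DD j k y) (DD i l y) -
  \sum_p christoffel g p j k y *
    (dotp (DD i p y) (D l y) + dotp (D p y) (DD i l y)).
Proof.
move=> Uy; apply/eqP; rewrite eq_sym subr_eq; apply/eqP.
have P : partial i (fun z => \sum_p christoffel g p j k z * g z p l) y =
    dotp (vpartial i (DD j k) y) (D l y) + dotp (DD j k y) (DD i l y).
  apply: etrans (partial_dotp i (sDD j k) (sD l) Uy).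
  by apply: (partial_near U_open) => // z; exact: christoffel_lower.
apply: (etrans (esym P)) => {P}.
have dg p : derivable (fun z => g z p l) y (delta_mx 0 i).
  have H : \near y, dotp (D p y) (D l y) = g y p l.
    by apply: filterS (open_near U_open Uy) => z Uz; rewrite gramE.
  apply: near_eq_derivable H _.
  by have [] := is_derive_dotp_smooth i (sD p) (sD l) Uy.
rewrite /partial.
have -> : (fun z => \sum_p christoffel g p j k z * g z p l) =
   \sum_(p < m) (christoffel g p j k * (fun z => g z p l)).
  by apply/funext => z; rewrite fct_sumE.
rewrite derive_sum => [|p]; last by apply: derivableM => //; exact: derivable_christoffel.
rewrite -big_split /=; apply: eq_bigr => p _.
rewrite deriveM//; last exact: derivable_christoffel.
have Pg := partial_gram i p l Uy; rewrite /partial in Pg.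
by rewrite Pg addrC; congr (_ + _); exact: mulrC.
Qed.

(** Since [sff] is normal, the tangential part of its second factor may be
    dropped. *)
Lemma dotp_sff a b c d y : U y ->
  dotp (sff a b y) (sff c d y) = dotp (DD a b y) (DD c d y) -
    \sum_p christoffel g p a b y * dotp (D p y) (DD c d y).
Proof.
move=> Uy; rewrite {2}/sff dotpDr dotpNr dotp_sumr [X in _ - X]big1; last first.
  by move=> p _; rewrite dotpZr sff_normal// mulr0.
rewrite subr0 dotpDl dotpNl dotp_suml; congr (_ - _).
by apply: eq_bigr => p _; rewrite dotpZl.
Qed.

Lemma gauss_equation i j k l y : U y ->
  \sum_s riemann g s k i j y * g y s l =
  dotp (sff j k y) (sff i l y) - dotp (sff i k y) (sff j l y).
Proof.
move=> Uy.
apply: (etrans _ (esym (f_equal2 (fun a b : R => a - b)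
  (dotp_sff j k i l Uy) (dotp_sff i k j l Uy)))).
have H2 := partial_christoffel_lower j i k l Uy.
rewrite (vpartialC U_open j i (sD k) Uy) in H2.
exact: (gauss_algebra (partial_christoffel_lower i j k l Uy) H2
  (fun p => christoffel_lower i p l Uy) (fun p => christoffel_lower j p l Uy)).
Qed.

Definition sff_mx y (a : 'I_N) : 'M[R]_m := \matrix_(i, j) sff i j y 0 a.

Lemma sff_mx_sym y a : U y -> (sff_mx y a)^T = sff_mx y a.
Proof. by move=> Uy; apply/matrixP => i j; rewrite mxE [LHS]mxE [RHS]mxE sffC. Qed.

Lemma vform_sff y u v : vform (sff_mx y) u v =
  \sum_i u 0 i *: \sum_j v 0 j *: sff i j y.
Proof.
apply/rowP => a; rewrite !mxE summxE /dotp.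
under eq_bigr do rewrite mxE mulr_suml.
rewrite exchange_big /=; apply: eq_bigr => i _.
rewrite mxE summxE mulr_sumr; apply: eq_bigr => j _.
by rewrite !mxE; ring.
Qed.

Lemma gauss_curvature_term y u v : U y ->
  inner g y (curv_op g y u v v) u =
  dotp (vform (sff_mx y) u u) (vform (sff_mx y) v v) -
  dotp (vform (sff_mx y) u v) (vform (sff_mx y) u v).
Proof.
move=> Uy.
apply: (etrans (curvature_contract u v (fun i j k q => gauss_equation i j k q Uy))).
rewrite -!vform_sff (vformC (fun a => sff_mx_sym a Uy) v u).
by rewrite (dotpC (vform _ v v)).
Qed.
End Gauss.


(** * Immersions into the product of a sphere and a Euclidean space *)

Lemma dotp_row_mx (R : realType) (k l : nat) (a c : 'rV[R]_k) (b d : 'rV[R]_l) :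
  dotp (row_mx a b) (row_mx c d) = dotp a c + dotp b d.
Proof. by rewrite !dotpE tr_row_mx mul_row_col mxE. Qed.

Section RowMap.
Variables (R : realType) (m k l : nat).
Variables (f1 : 'rV[R]_m -> 'rV[R]_k) (f2 : 'rV[R]_m -> 'rV[R]_l).

Lemma row_map_coord a : (fun y => row_mx (f1 y) (f2 y) 0 a) =
  match fintype.split a with
  | inl b => fun y => f1 y 0 b
  | inr b => fun y => f2 y 0 b
  end.
Proof. by apply/funext => y; rewrite mxE; case: (fintype.split a). Qed.

Lemma smooth_row_map U : smooth_map_on U f1 -> smooth_map_on U f2 ->
  smooth_map_on U (fun y => row_mx (f1 y) (f2 y)).
Proof. by move=> s1 s2 a; rewrite row_map_coord; case: (fintype.split a). Qed.

Lemma vpartial_row_map i : vpartial i (fun y => row_mx (f1 y) (f2 y)) =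
  (fun y => row_mx (vpartial i f1 y) (vpartial i f2 y)).
Proof.
apply/funext => y; apply/rowP => a; rewrite mxE row_map_coord mxE.
by case: (fintype.split a) => b; rewrite mxE.
Qed.

Lemma jac_row_map y : jac (fun z => row_mx (f1 z) (f2 z)) y =
  row_mx (jac f1 y) (jac f2 y).
Proof.
apply/row_matrixP => i; rewrite row_row_mx !row_jac.
by rewrite vpartial_row_map.
Qed.
End RowMap.

Lemma is_derive_smooth_map (R : realType) (m N : nat) (U : set 'rV[R]_m)
    (G : 'rV[R]_m -> 'rV[R]_N) (x u : 'rV[R]_m) (a : 'I_N) :
  open U -> smooth_map_on U G -> U x ->
  is_derive x u (fun y => G y 0 a) ((\sum_i u 0 i *: vpartial i G x) 0 a).
Proof.
move=> oU sG Ux; apply: is_derive_eq (smooth_is_derive oU u (sG a) Ux) _.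
by rewrite summxE; apply: eq_bigr => i _; rewrite !mxE.
Qed.

(** At a minimum of a height function, its second derivative along [u] is the
    quadratic form of the second partial derivatives, because all derivatives
    involved are continuous. *)
Lemma height_derivative_test (R : realType) (m N : nat) (U : set 'rV[R]_m)
    (G : 'rV[R]_m -> 'rV[R]_N) (x : 'rV[R]_m) (e : 'rV[R]_N) :
  open U -> smooth_map_on U G -> U x ->
  (forall y, dotp e (G x) <= dotp e (G y)) ->
  (forall i, dotp e (vpartial i G x) = 0) /\
  forall u : 'rV[R]_m, 0 <= \sum_i u 0 i * \sum_j u 0 j * dotp e (vpartial j (vpartial i G) x).
Proof.
move=> oU sG Ux emin.
have D (H : 'rV[R]_m -> 'rV[R]_N) (u y : 'rV[R]_m) : smooth_map_on U H -> U y ->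
    is_derive y u (fun z => dotp e (H z)) (\sum_j u 0 j * dotp e (vpartial j H y)).
  move=> sH Uy.
  have := @is_derive_dotp R N _ (cst e) H y u 0 _ _
    (fun a => is_derive_smooth_map u a oU sH Uy).
  rewrite dot0p add0r dotp_sumr; under eq_bigr do rewrite dotpZr.
  by apply=> a; rewrite mxE; exact: is_derive_cst.
have T (u : 'rV[R]_m) : \sum_i u 0 i * dotp e (vpartial i G x) = 0 /\
   0 <= \sum_i u 0 i * \sum_j u 0 j * dotp e (vpartial j (vpartial i G) x).
  apply: (@second_derivative_test R _ (fun y => dotp e (G y))
     (fun y => \sum_i u 0 i * dotp e (vpartial i G y)) x u) => //.
    by apply: filterS (open_near oU Ux) => y; exact: D.
  have -> : (fun y => \sum_i u 0 i * dotp e (vpartial i G y)) =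
     \sum_(i < m) (u 0 i *: (fun y => dotp e (vpartial i G y))).
    by apply/funext => y; rewrite fct_sumE.
  apply: is_derive_sum => i; apply: is_deriveZ.
  by apply: D => //; exact: smooth_vpartial.
split=> [i|u]; last by have [] := T u.
have [+ _] := T (delta_mx 0 i).
rewrite (bigD1 i)//= big1 => [|j ji].
  by rewrite mxE !eqxx mul1r addr0.
by rewrite mxE (negPf ji) andbF mul0r.
Qed.

(** In one chart: [f1] and [f2] are the spherical and Euclidean components of the
    immersion [F], and [x] minimises the height of [f1] above the hyperplane
    orthogonal to [e].  [nu] is the normal of the cylinder over the sphere,
    [E] is [e] seen in the total space, and the kernel of [L] consists of the
    tangent vectors with vanishing Euclidean component. *)
Section LocalCurvature.
Variables (R : realType) (m k l : nat) (U : set 'rV[R]_m).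
Variables (f1 : 'rV[R]_m -> 'rV[R]_k) (f2 : 'rV[R]_m -> 'rV[R]_l).
Variables (g : 'rV[R]_m -> 'M[R]_m) (x : 'rV[R]_m) (e : 'rV[R]_k).
Local Notation F := (fun y => row_mx (f1 y) (f2 y)).
Hypothesis U_open : open U.
Hypothesis Ux : U x.
Hypothesis smooth1 : smooth_map_on U f1.
Hypothesis smooth2 : smooth_map_on U f2.
Hypothesis F_imm : forall y, U y -> row_free (jac F y).
Hypothesis F_isom : forall y, U y -> g y = jac F y *m (jac F y)^T.
Hypothesis f1_sphere : forall y, dotp (f1 y) (f1 y) = 1.
Hypothesis e_min : forall y, dotp e (f1 x) <= dotp e (f1 y).
Hypothesis e_pos : 0 < dotp e (f1 x).
Hypothesis dim : (k + 2 * l <= 2 * m)%N.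

Let F_smooth : smooth_map_on U F.
Proof. exact: smooth_row_map. Qed.

Lemma sphere_normal1 i y : U y -> dotp (f1 y) (vpartial i f1 y) = 0.
Proof.
move=> Uy; have := partial_dotp i smooth1 smooth1 Uy.
rewrite (partial_near U_open (f' := cst 1)) // /partial derive_cst.
by rewrite (dotpC (vpartial i f1 y)) => /esym; lra.
Qed.

Lemma sphere_normal2 i j : dotp (f1 x) (vpartial i (vpartial j f1) x) =
  - dotp (vpartial i f1 x) (vpartial j f1 x).
Proof.
have := partial_dotp i smooth1 (smooth_vpartial j smooth1) Ux.
rewrite (partial_near U_open (f' := cst 0) i Ux); last first.
  by move=> y; exact: sphere_normal1.
rewrite /partial derive_cst => /esym; lra.
Qed.

Let nu : 'rV[R]_(k + l) := row_mx (f1 x) 0.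
Let E : 'rV[R]_(k + l) := row_mx e 0.
Let J := jac F x.
Let L := jac f2 x.
Let B := sff_mx F g x.
(* on the kernel of [L], [vform A] is the second fundamental form of [F] in the
   product *)
Let A a := B a + nu 0 a *: g x.
Let gg u v := dotp (u *m J) (v *m J).

Let nu_nu : dotp nu nu = 1.
Proof. by rewrite dotp_row_mx dot0p addr0. Qed.

Let nu_D i : dotp nu (vpartial i F x) = 0.
Proof. by rewrite vpartial_row_map dotp_row_mx dot0p addr0 sphere_normal1. Qed.

Let nu_J u : dotp nu (u *m J) = 0.
Proof.
by rewrite mulmx_jac dotp_sumr big1// => i _; rewrite dotpZr nu_D mulr0.
Qed.

Let E_D i : dotp E (vpartial i F x) = 0.
Proof.
rewrite vpartial_row_map dotp_row_mx dot0p addr0.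
by have [] := height_derivative_test U_open smooth1 Ux e_min.
Qed.

Let sff_dotp w i j : (forall p, dotp w (vpartial p F x) = 0) ->
  dotp w (sff F g i j x) = dotp w (vpartial i (vpartial j F) x).
Proof.
move=> wD; rewrite dotpDr dotpNr dotp_sumr big1 ?subr0// => p _.
by rewrite dotpZr wD mulr0.
Qed.

Let vform_dotp w u v : (forall p, dotp w (vpartial p F x) = 0) ->
  dotp w (vform B u v) =
  \sum_i u 0 i * \sum_j v 0 j * dotp w (vpartial i (vpartial j F) x).
Proof.
move=> wD; rewrite vform_sff dotp_sumr; apply: eq_bigr => i _.
rewrite dotpZr dotp_sumr; congr (_ * _); apply: eq_bigr => j _.
by rewrite dotpZr sff_dotp.
Qed.

Let inner_gg u v : inner g x u v = gg u v.
Proof. by rewrite /inner F_isom// /gg dotpE trmx_mul !mulmxA. Qed.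

Let vformA u v : vform A u v = vform B u v + gg u v *: nu.
Proof.
have -> : gg u v = dotp (u *m g x) v by rewrite -inner_gg dotpE.
apply/rowP => a; rewrite mxE [RHS]mxE [in RHS]mxE [X in _ = _ + X]mxE.
by rewrite /A mulmxDr dotpDl -scalemxAr dotpZl [X in _ + X]mulrC.
Qed.

Let A_sym a : (A a)^T = A a.
Proof.
rewrite /A linearD linearZ /= (sff_mx_sym U_open F_smooth F_isom)//; congr (_ + _ *: _).
by rewrite F_isom// trmx_mul trmxK.
Qed.

Let vformB_J u v w : dotp (vform B u v) (w *m J) = 0.
Proof.
rewrite mulmx_jac dotp_sumr big1// => i _; rewrite dotpZr vform_sff.
rewrite dotp_suml big1 ?mulr0// => j _; rewrite dotpZl dotp_suml big1 ?mulr0// => p _.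
by rewrite dotpZl (sff_normal U_open F_smooth F_imm F_isom)// mulr0.
Qed.

Let ker_gg u v : u *m L = 0 -> gg u v = dotp (u *m jac f1 x) (v *m jac f1 x).
Proof.
move=> uL; rewrite /gg /J jac_row_map !mul_mx_row dotp_row_mx.
by rewrite uL dot0p addr0.
Qed.

(** The sphere has second fundamental form minus the inner product, with respect
    to its outer normal. *)
Let nu_vformB u v : u *m L = 0 -> dotp nu (vform B u v) = - gg u v.
Proof.
move=> uL; rewrite (vform_dotp _ _ nu_D) ker_gg// !mulmx_jac.
rewrite dotp_suml -sumrN; apply: eq_bigr => i _.
rewrite dotpZl dotp_sumr -mulrN -sumrN; congr (_ * _); apply: eq_bigr => j _.
rewrite dotpZr !vpartial_row_map dotp_row_mx dot0p addr0.
by rewrite sphere_normal2 mulrN.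
Qed.

Let nu_vformA u v : u *m L = 0 -> dotp nu (vform A u v) = 0.
Proof.
by move=> uL; rewrite vformA dotpDr nu_vformB// dotpZr nu_nu mulr1 addNr.
Qed.

Let S := col_mx J nu.

Let S_free : row_free S.
Proof.
apply: inj_row_free => v; rewrite -[v]hsubmxK mul_row_col => H.
have c0 : rsubmx v = 0.
  have : dotp nu (lsubmx v *m J + rsubmx v *m nu) = 0 by rewrite H dotp0.
  rewrite dotpDr nu_J add0r [rsubmx v]mx11_scalar mul_scalar_mx dotpZr nu_nu.
  by rewrite mulr1 => ->; rewrite raddf0.
move: H; rewrite c0 mul0mx addr0 => H.
by rewrite (row_free_inj (F_imm Ux) (etrans H (esym (mul0mx _ _)))) row_mx0.
Qed.

Let A_normal u v : u *m L = 0 -> v *m L = 0 -> vform A u v *m S^T = 0.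
Proof.
move=> uL vL; rewrite tr_col_mx mul_mx_row.
have -> : vform A u v *m nu^T = 0.
  by apply/rowP => i; rewrite ord1 -dotpE mxE dotpC nu_vformA.
have -> : vform A u v *m J^T = 0.
  apply/rowP => i.
  have -> : (vform A u v *m J^T) 0 i = dotp (vform A u v) (row i J).
    by rewrite mxE; apply: eq_bigr => a _; rewrite !mxE.
  rewrite rowE.
  by rewrite vformA dotpDl vformB_J add0r dotpZl nu_J mulr0 mxE.
by rewrite row_mx0.
Qed.

(** The Hessian of the height contributes a nonnegative term, and [alpha] adds
    the squared length of [u] times the positive height at [x]. *)
Let E_vformA u : u *m L = 0 -> u != 0 -> 0 < dotp E (vform A u u).
Proof.
move=> uL u0; rewrite vformA dotpDr dotpZr ltr_wpDl//.
  rewrite (vform_dotp _ _ E_D).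
  have [_ /(_ u)] := height_derivative_test U_open smooth1 Ux e_min.
  congr (_ <= _); apply: eq_bigr => i _; congr (_ * _); apply: eq_bigr => j _.
  rewrite !vpartial_row_map dotp_row_mx dot0p addr0.
  by rewrite (vpartialC U_open j i smooth1 Ux).
rewrite dotp_row_mx dot0p addr0 mulr_gt0// dotp_gt0.
apply: contra u0 => /eqP uJ.
by apply/eqP/(row_free_inj (F_imm Ux)); rewrite -/J uJ mul0mx.
Qed.

(** For the vectors given by Otsuki's lemma the mixed term of the Gauss equation
    vanishes, and replacing [B] by [alpha] adds [|u|^2 |v|^2] to the
    remaining term, that is, 1 to the sectional curvature. *)
Lemma exists_sectional_gt1 : exists u v : 'rV[R]_m,
  row_free (col_mx u v) /\ 1 < sectional g x u v.
Proof.
have A_neq0 u : u *m L = 0 -> u != 0 -> vform A u u != 0.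
  move=> uL u0; apply/eqP => H; have := E_vformA uL u0.
  by rewrite H dotp0 ltxx.
have dim' : (l + (k + l) < m + (m + 1))%N by move: dim; lia.
have [u [v [[uL u0] [vL v0] uv Auv pos]]] :=
  otsuki A_sym (F_imm Ux) S_free A_normal A_neq0 dim'.
have {}uv : gg u v = 0 by [].
have gu : 0 < gg u u.
  rewrite dotp_gt0; apply: contra u0 => /eqP uJ.
  by apply/eqP/(row_free_inj (F_imm Ux)); rewrite -/J uJ mul0mx.
have gv : 0 < gg v v.
  rewrite dotp_gt0; apply: contra v0 => /eqP vJ.
  by apply/eqP/(row_free_inj (F_imm Ux)); rewrite -/J vJ mul0mx.
exists u, v; split.
  apply: inj_row_free => w; rewrite -[w]hsubmxK mul_row_col.
  rewrite [lsubmx w]mx11_scalar [rsubmx w]mx11_scalar !mul_scalar_mx.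
  set a := lsubmx w 0 0; set b := rsubmx w 0 0 => H.
  have a0 : a = 0.
    have : gg (a *: u + b *: v) u = 0 by rewrite H /gg mul0mx dot0p.
    rewrite /gg mulmxDl -!scalemxAl dotpDl !dotpZl (dotpC (v *m J)).
    rewrite -/(gg u v) uv mulr0 addr0 => /eqP.
    by rewrite mulf_eq0 (gt_eqF gu) orbF => /eqP.
  have b0 : b = 0.
    have : gg (a *: u + b *: v) v = 0 by rewrite H /gg mul0mx dot0p.
    rewrite /gg mulmxDl -!scalemxAl dotpDl !dotpZl.
    rewrite -/(gg u v) uv mulr0 add0r => /eqP.
    by rewrite mulf_eq0 (gt_eqF gv) orbF => /eqP.
  by rewrite a0 b0 !raddf0 row_mx0.
rewrite /sectional (gauss_curvature_term U_open F_smooth F_imm F_isom)//.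
have Buv : vform B u v = 0.
  by move: Auv; rewrite vformA uv scale0r addr0.
have BB : dotp (vform B u u) (vform B v v) =
    dotp (vform A u u) (vform A v v) + gg u u * gg v v.
  rewrite !vformA !(dotpDl, dotpDr, dotpZl, dotpZr) (dotpC _ nu).
  by rewrite !nu_vformB// nu_nu; ring.
rewrite -/B Buv dot0p subr0 !inner_gg uv expr0n subr0 BB.
by rewrite ltr_pdivlMr ?mulr_gt0// mul1r ltrDr.
Qed.
End LocalCurvature.


(** Smoothness is only known in charts; near [p] the immersion is its expression
    in a chart composed with the chart map. *)
Lemma immersion_continuous1 (R : realType) (m k l : nat)
    (M : riemannianManifold R m) (phi : M -> 'rV[R]_k.+1 * 'rV[R]_l) a :
  isometric_immersion phi -> continuous (fun p => (phi p).1 0 a).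
Proof.
move=> hphi p; have [c ac cp] := atlas_cover p.
have cc : {for p, continuous (cmap c)}.
  have := @cmap_cont _ _ _ c; rewrite continuous_open_subspace; last exact: cdom_open.
  by apply; rewrite inE.
have Ucp : cimg c (cmap c p) by exists p.
have cf := smooth_continuous (imm_smooth1 hphi ac a) Ucp.
have ch := continuous_comp cc cf.
rewrite /continuous_at -[in X in _ --> X](@cmapK _ _ _ c p) ?inE//.
apply: cvg_trans ch; apply: near_eq_cvg.
have : \forall q \near p, cdom c q.
  by apply: open_nbhs_nbhs; split=> //; exact: cdom_open.
by apply: filterS => q cq /=; rewrite cmapK ?inE.
Qed.

Lemma immersion_isom (R : realType) (m k l : nat)
    (M : riemannianManifold R m) (phi : M -> 'rV[R]_k.+1 * 'rV[R]_l)
    (c : chart R m M) y :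
  isometric_immersion phi -> atlas c -> cimg c y ->
  let J := jac (fun z => row_mx (phi (cinv c z)).1 (phi (cinv c z)).2) y in
  metric c y = J *m J^T.
Proof.
move=> hphi ac Uy /=; rewrite (jac_row_map (fun z => (phi (cinv c z)).1)).
apply/matrixP => i j.
have := imm_isometric hphi ac Uy (delta_mx 0 i) (delta_mx 0 j).
rewrite /inner -!rowE -dotp_row_mx -!row_row_mx => H.
transitivity ((row i (metric c y) *m (delta_mx 0 j : 'rV[R]_m)^T) 0 0).
  by rewrite trmx_delta -colE !mxE.
by rewrite H mxE; apply: eq_bigr => a _; rewrite !mxE.
Qed.

Theorem corollary6 (R : realType) (m n l : nat) (hl : (l <= n)%N)
  (M : riemannianManifold R m) (hM : compact [set: M])
  (phi : M -> 'rV[R]_(n - l).+1 * 'rV[R]_l)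
  (hphi : isometric_immersion phi)
  (hdim : (n + l + 1 <= 2 * m)%N)
  (hK : (sup_sectional M <= 1%:E)%E) :
  ((pi / 2)%:E <= extrinsic_radius phi)%E.
Proof.
apply: le_ereal_inf_tmp => _ [e [r [_ r0 sub ->]]].
rewrite lee_fin leNgt; apply/negP => rpi.
have pos p : 0 < dotp e (phi p).1.
  by apply: (geodesic_ball_dotp_gt0 r0 rpi); apply: sub; exists p.
have cont : {within [set: M], continuous (fun p => dotp e (phi p).1)}.
  apply: continuous_subspaceT => p.
  apply: (@continuous_dotp R _ M (cst e) (fun q => (phi q).1) p) => a.
    exact: cst_continuous.
  exact: immersion_continuous1.
have [p _ pmin] := compact_EVT_min (@manifold_nonempty _ _ M) hM cont.
have [c ac cp] := atlas_cover p.
have Up : cimg c (cmap c p) by exists p.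
have pE : cinv c (cmap c p) = p by rewrite cmapK// inE.
have [|||||||||u [v [uv K1]]] := @exists_sectional_gt1 R m (n - l).+1 l (cimg c)
  (fun z => (phi (cinv c z)).1) (fun z => (phi (cinv c z)).2)
  (metric c) (cmap c p) e _ Up _ _ _ _ _ _ _ _.
- exact: cimg_open.
- exact: imm_smooth1.
- exact: imm_smooth2.
- move=> y Uy; rewrite (jac_row_map (fun z => (phi (cinv c z)).1)).
  exact: imm_inj.
- by move=> y Uy; exact: immersion_isom.
- by move=> y; exact: (imm_target hphi).
- by move=> y; rewrite pE; apply: pmin; rewrite inE.
- by rewrite pE.
- by move: hdim hl; lia.
have : ((sectional (metric c) (cmap c p) u v)%:E <= sup_sectional M)%E.
  by apply: ereal_sup_ubound; exists c, p, u, v.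
move=> /le_trans/(_ hK); rewrite lee_fin.
by rewrite leNgt K1.
Qed.
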